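(* Let $M$ be a pillow box given by fundamental data $(b,\zeta(s),\,0\le s\le L)$. Denote by $X:U\to\mathbb{R}^3$ the origami-parametrization of a quarter domain $P$ of $M$, with developing map $Y:U\to\mathbb{R}^3$. Suppose there exist continuous functions $\lambda(t)$ and $\mu(t)$ $(t\in[0,1])$ such that $$\mu(0)=\mu(1)=\lambda(1)=0,\qquad \lambda(0)=1,\qquad (1+\lambda(t)^2)\,\zeta'(s)^2<1$$ hold for every $t\in[0,1]$ and $s\in(0,L)$. Then, define $X^t:U\to\mathbb{R}^3$ for each $t\in[0,1]$ by $$X^t(s,v):=\begin{cases}p^t(s,v)=\boldsymbol{c}^t(s)+v\,\xi^t & ((s,v)\in U_+),\\ q^t(s,v)=\boldsymbol{c}^t(s)+v\,\check\xi & ((s,v)\in U_-),\end{cases}$$ where $\check\xi=(0,-1,0)$ and $$\boldsymbol{c}^t(s)=\left(\int_0^s\sqrt{1-(1+\lambda(t)^2)\zeta'(w)^2}\,dw+\mu(t),\ \zeta(s),\ \lambda(t)\zeta(s)\right),$$ $$\xi^t=\frac{1}{1+\lambda(t)^2}\bigl(0,\ \lambda(t)^2-1,\ -2\lambda(t)\bigr).$$ Then the family $\{X^t:U\to\mathbb{R}^3\}_{t\in[0,1]}$ is a quarter origami deformation from $X$ to $Y$. Conversely, every quarter origami deformation $\{X^t:U\to\mathbb{R}^3\}_{t\in[0,1]}$ (from $X$ to $Y$) is given in this form.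
   Context: **Fundamental data.** A pair $(b,\zeta)$, where $b>0$ and $\zeta:[0,L]\to\mathbb{R}$ is a smooth function with $1-2\zeta'(s)^2>0$, $\zeta(0)=\zeta(L)=0$, and $0<\zeta(s)<b$, $\zeta''(s)<0$ for $s\in(0,L)$. Put $U=\{(s,v): 0\le s\le L,\ \zeta(s)-b\le v\le\zeta(s)\}$, $U_+=\{(s,v): 0\le s\le L,\ 0\le v\le\zeta(s)\}$, $U_-=\{(s,v): 0\le s\le L,\ \zeta(s)-b\le v\le 0\}$, $\xi=(0,0,-1)$, $\check\xi=(0,-1,0)$. **Pillow box and origami-parametrization.** Let $\boldsymbol{c}(s)=\left(\int_0^s\sqrt{1-2\zeta'(w)^2}\,dw,\ \zeta(s),\ \zeta(s)\right)$. The origami-parametrization is $X:U\to\mathbb{R}^3$ with $X(s,v)=\boldsymbol{c}(s)+v\xi$ on $U_+$ and $X(s,v)=\boldsymbol{c}(s)+v\check\xi$ on $U_-$. The quarter domain is $P=X(U)$, and the pillow box with these data is $M=P\cup\rho_V(P)\cup\rho_H(P)\cup\rho_H\circ\rho_V(P)$, where $\rho_V(x,y,z)=(x,2b-y,z)$ and $\rho_H(x,y,z)=(x,y,-z)$. **Developing map.** $Y:U\to\mathbb{R}^3$, $Y(s,v)=\gamma(s)+v\check\xi$, where $\gamma(s)=\left(\int_0^s\sqrt{1-\zeta'(w)^2}\,dw,\ \zeta(s),\ 0\right)$. Both $X$ (on each of $U_\pm$) and $Y$ have first fundamental form $g=ds^2-2\zeta'(s)\,ds\,dv+dv^2$. **Origami-maps.**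 Let $J$ be a non-empty closed bounded interval and $\boldsymbol{c}:J\to\mathbb{R}^3$ an injective regular curve parametrized by arc length whose curvature function $\kappa$ is positive on $J$, with $T=\boldsymbol{c}'$, $N=T'/\kappa$, $B=T\times N$ and torsion $\tau=N'\cdot B$. Let $\alpha,\beta$ be smooth functions on $J$ with $0<|\alpha(s)|<\pi/2$ and $0<\beta(s)<\pi$ for $s\in J$, and put $p(s,v)=\boldsymbol{c}(s)+v\,\eta(s)$ with $\eta=\cos\beta\,T+\sin\beta(\cos\alpha\,N+\sin\alpha\,B)$, considered on a domain $W=\{(s,v): s\in J,\ \delta(s)\le v\le\varepsilon(s)\}$, with $\delta<0<\varepsilon$ smooth functions on $J$, on which $p$ is an embedding. The functions $\alpha$ and $\beta$ are the first and second angular functions of $p$. If $p$ has zero Gaussian curvature (equivalently $\cot\beta=(\alpha'+\tau)/(\kappa\sin\alpha)$), it is called a developable surface along $\boldsymbol{c}$. If $p,q:W\to\mathbb{R}^3$ are developable surfaces along the same $\boldsymbol{c}$ with first angular functions $\alpha$ and $-\alpha$ respectively, the map equal to $p$ on $W_+=\{(s,v)\in W: v\ge0\}$ and to $q$ on $W_-=\{(s,v)\in W: v\le0\}$ is called an origami-map, and $\boldsymbol{c}(J)$ (or $\boldsymbol{c}$) its crease. Here this terminology is applied with $J=[0,L]$, $W=U$, $W_\pm=U_\pm$. **Quarter origami deformation from $X$ to $Y$.** A continuous $1$-parameter family $\{X^t:U\to\mathbb{R}^3\}_{t\in[0,1]}$ of origami-maps of the form $X^t(s,v)=p^t(s,v)=\boldsymbol{c}^t(s)+v\,\xi^t(s)$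 on $U_+$ and $X^t(s,v)=q^t(s,v)=\boldsymbol{c}^t(s)+v\,\check\xi$ on $U_-$, for each $t\in[0,1]$, such that (1) $X^0=X$ and $X^1=Y$; (2) for each $t\in[0,1]$, $X^t$ is isometric to both $X$ and $Y$, i.e. the first fundamental forms of $p^t$ and $q^t$ coincide with $g$ on $U_+$ and $U_-$ respectively; (3) the endpoints $\boldsymbol{c}^t(0)$ and $\boldsymbol{c}^t(L)$ of the crease lie on the $x$-axis for each $t\in[0,1]$.
   Formalization: As Y is planar and U pinches at s=0,L, each X^t may be an origami-map or unfolded (α identically 0); smoothness, positive curvature, angular functions, zero Gaussian curvature and δ<0<ε are required only for 0<s<L, while C^1, embedding and the first form hold on [0,L]. *)

(* Defs.v *)
From Stdlib Require Import Reals.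
From Coquelicot Require Import Coquelicot.
Open Scope R_scope.

(* Points and vectors are triples; sums and multiples are Coquelicot's [plus]
   and [scal] on the product module. *)
Notation R3 := (R * R * R)%type.

Definition px (u : R3) : R := fst (fst u).
Definition py (u : R3) : R := snd (fst u).
Definition pz (u : R3) : R := snd u.

Definition dot (u w : R3) : R := px u * px w + py u * py w + pz u * pz w.
Definition enorm (u : R3) : R := sqrt (dot u u).
Definition cross (u w : R3) : R3 :=
  (py u * pz w - pz u * py w,
   pz u * px w - px u * pz w,
   px u * py w - py u * px w).

Definition DeriveV (f : R -> R3) (s : R) : R3 :=
  (Derive (fun u => px (f u)) s,
   Derive (fun u => py (f u)) s,
   Derive (fun u => pz (f u)) s).

(* Derivative relative to [0, L]: one-sided at the two endpoints, so that only
   the restriction of f to [0, L] matters. *)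
Definition is_derive_in (L : R) (f : R -> R3) (s : R) (l : R3) : Prop :=
  filterdiff f (within (fun u => 0 <= u <= L) (locally s)) (fun h : R => scal h l).

Definition C1_closed (L : R) (f : R -> R3) : Prop :=
  exists f' : R -> R3,
    continuous_on (fun s => 0 <= s <= L) f' /\
    (forall s, 0 <= s <= L -> is_derive_in L f s (f' s)).

Definition smooth_open (L : R) (f : R -> R) : Prop :=
  forall (n : nat) s, 0 < s < L -> ex_derive_n f n s.

Definition smooth_openV (L : R) (f : R -> R3) : Prop :=
  smooth_open L (fun u => px (f u)) /\
  smooth_open L (fun u => py (f u)) /\
  smooth_open L (fun u => pz (f u)).

(* E, F, G are the coefficients at (s, v) of the first fundamental form of p;
   p may be defined for 0 <= s <= L only. *)
Definition is_first_form (L : R) (p : R -> R -> R3) (s v E F G : R) : Prop :=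
  exists ps pv : R3,
    is_derive_in L (fun u => p u v) s ps /\ is_derive (p s) v pv /\
    dot ps ps = E /\ dot ps pv = F /\ dot pv pv = G.

Definition immersive_at (L : R) (p : R -> R -> R3) (s v : R) : Prop :=
  exists ps pv : R3,
    is_derive_in L (fun u => p u v) s ps /\ is_derive (p s) v pv /\
    cross ps pv <> (0, 0, 0).

Definition gauss_curvature (p : R -> R -> R3) (s v : R) : R :=
  let ps := DeriveV (fun u => p u v) s in
  let pv := DeriveV (p s) v in
  let pss := DeriveV (fun u => DeriveV (fun u' => p u' v) u) s in
  let psv := DeriveV (fun u => DeriveV (p u) v) s in
  let pvv := DeriveV (fun w => DeriveV (p s) w) v in
  let nu := scal (/ enorm (cross ps pv)) (cross ps pv) in
  (dot pss nu * dot pvv nu - (dot psv nu) ^ 2) /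
  (dot ps ps * dot pv pv - (dot ps pv) ^ 2).

Definition ruled (c eta : R -> R3) (s v : R) : R3 := plus (c s) (scal v (eta s)).

Definition Tvec (c : R -> R3) : R -> R3 := DeriveV c.
Definition kappa (c : R -> R3) (s : R) : R := enorm (DeriveV (Tvec c) s).
Definition Nvec (c : R -> R3) (s : R) : R3 := scal (/ kappa c s) (DeriveV (Tvec c) s).
Definition Bvec (c : R -> R3) (s : R) : R3 := cross (Tvec c s) (Nvec c s).

Definition strip (L : R) (delta epsilon : R -> R) (s v : R) : Prop :=
  0 <= s <= L /\ delta s <= v <= epsilon s.

(* The conditions involving curvature, angles and higher derivatives are
   imposed on the open interval (0, L) only.  For a pillow box the upper
   boundary zeta of the domain vanishes at s = 0, L, zeta'' may vanish there
   (and then so does the curvature of the crease), and when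
   (1 + lambda(t)^2) zeta'^2 = 1 at an endpoint the crease is only of class C^1
   there. On the closed interval the crease is an injective C^1 curve
   parametrized by arc length. *)
Definition is_crease (L : R) (c : R -> R3) : Prop :=
  C1_closed L c /\
  smooth_openV L c /\
  (forall s l, 0 <= s <= L -> is_derive_in L c s l -> enorm l = 1) /\
  (forall s s', 0 <= s <= L -> 0 <= s' <= L -> c s = c s' -> s = s') /\
  (forall s, 0 < s < L -> 0 < kappa c s).

Definition is_strip (L : R) (delta epsilon : R -> R) : Prop :=
  smooth_open L delta /\ smooth_open L epsilon /\
  (forall s, 0 < s < L -> delta s < 0 < epsilon s).

(* [ruled c eta] is a developable surface along c with first angular function
   alpha.  The domain is compact, so an injective immersion of it is an
   embedding.  The value alpha = 0 is not excluded here. *)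
Definition developable_along (L : R) (delta epsilon : R -> R)
    (c eta : R -> R3) (alpha : R -> R) : Prop :=
  C1_closed L eta /\
  smooth_open L alpha /\
  (forall s, 0 < s < L -> Rabs (alpha s) < PI / 2) /\
  (exists beta : R -> R,
     smooth_open L beta /\
     (forall s, 0 < s < L -> 0 < beta s < PI) /\
     (forall s, 0 < s < L ->
        eta s = plus (scal (cos (beta s)) (Tvec c s))
                  (scal (sin (beta s))
                     (plus (scal (cos (alpha s)) (Nvec c s))
                           (scal (sin (alpha s)) (Bvec c s)))))) /\
  (forall s v s' v', strip L delta epsilon s v -> strip L delta epsilon s' v' ->
     ruled c eta s v = ruled c eta s' v' -> s = s' /\ v = v') /\
  (forall s v, strip L delta epsilon s v -> immersive_at L (ruled c eta) s v) /\
  (forall s v, 0 < s < L -> delta s <= v <= epsilon s ->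
     gauss_curvature (ruled c eta) s v = 0).

Definition opposite_angles (L : R) (delta epsilon : R -> R)
    (c xi1 xi2 : R -> R3) (alpha : R -> R) : Prop :=
  is_strip L delta epsilon /\ is_crease L c /\
  developable_along L delta epsilon c xi1 alpha /\
  developable_along L delta epsilon c xi2 (fun s => - alpha s).

Definition glued (L : R) (delta epsilon : R -> R)
    (c xi1 xi2 : R -> R3) (X : R -> R -> R3) : Prop :=
  (forall s v, strip L delta epsilon s v -> 0 <= v -> X s v = ruled c xi1 s v) /\
  (forall s v, strip L delta epsilon s v -> v <= 0 -> X s v = ruled c xi2 s v).

Definition origami_map (L : R) (delta epsilon : R -> R)
    (c xi1 xi2 : R -> R3) (X : R -> R -> R3) : Prop :=
  glued L delta epsilon c xi1 xi2 X /\
  exists alpha, opposite_angles L delta epsilon c xi1 xi2 alpha /\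
    (forall s, 0 < s < L -> 0 < Rabs (alpha s)).

(* The unfolded limit of an origami-map, with alpha identically zero.  The
   developing map is of this kind. *)
Definition unfolded_map (L : R) (delta epsilon : R -> R)
    (c xi1 xi2 : R -> R3) (X : R -> R -> R3) : Prop :=
  glued L delta epsilon c xi1 xi2 X /\
  exists alpha, opposite_angles L delta epsilon c xi1 xi2 alpha /\
    (forall s, 0 < s < L -> alpha s = 0).

(* A smooth function on [0, L] is given by a function on R which is smooth at
   every point of [0, L], so that [Derive zeta] is the one-sided derivative at
   the endpoints; its values off [0, L] are irrelevant. *)
Definition fundamental_data (b L : R) (zeta : R -> R) : Prop :=
  0 < b /\ 0 < L /\
  (forall (n : nat) s, 0 <= s <= L -> ex_derive_n zeta n s) /\
  (forall s, 0 <= s <= L -> 0 < 1 - 2 * (Derive zeta s) ^ 2) /\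
  zeta 0 = 0 /\ zeta L = 0 /\
  (forall s, 0 < s < L -> 0 < zeta s < b) /\
  (forall s, 0 < s < L -> Derive_n zeta 2 s < 0).

Definition U (b L : R) (zeta : R -> R) : R -> R -> Prop :=
  strip L (fun s => zeta s - b) zeta.

Definition xi : R3 := (0, 0, -1).
Definition xi_check : R3 := (0, -1, 0).

Definition pillow_crease (zeta : R -> R) (s : R) : R3 :=
  (RInt (fun w => sqrt (1 - 2 * (Derive zeta w) ^ 2)) 0 s, zeta s, zeta s).

Definition origami_param (zeta : R -> R) (s v : R) : R3 :=
  if Rle_dec 0 v then plus (pillow_crease zeta s) (scal v xi)
  else plus (pillow_crease zeta s) (scal v xi_check).

Definition developing_crease (zeta : R -> R) (s : R) : R3 :=
  (RInt (fun w => sqrt (1 - (Derive zeta w) ^ 2)) 0 s, zeta s, 0).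

Definition developing_map (zeta : R -> R) (s v : R) : R3 :=
  plus (developing_crease zeta s) (scal v xi_check).

Definition rho_V (b : R) (u : R3) : R3 := (px u, 2 * b - py u, pz u).
Definition rho_H (u : R3) : R3 := (px u, py u, - pz u).

Definition quarter_domain (b L : R) (zeta : R -> R) (u : R3) : Prop :=
  exists s v, U b L zeta s v /\ u = origami_param zeta s v.

Definition is_pillow_box (b L : R) (zeta : R -> R) (M : R3 -> Prop) : Prop :=
  fundamental_data b L zeta /\
  forall u, M u <->
    exists w, quarter_domain b L zeta w /\
      (u = w \/ u = rho_V b w \/ u = rho_H w \/ u = rho_H (rho_V b w)).

Definition on_x_axis (u : R3) : Prop := py u = 0 /\ pz u = 0.

Definition quarter_origami_deformation (b L : R) (zeta : R -> R)
    (X : R -> R -> R -> R3) : Prop :=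
  continuous_on
    (fun q : R * R * R => 0 <= fst (fst q) <= 1 /\ U b L zeta (snd (fst q)) (snd q))
    (fun q : R * R * R => X (fst (fst q)) (snd (fst q)) (snd q)) /\
  (forall s v, U b L zeta s v -> X 0 s v = origami_param zeta s v) /\
  (forall s v, U b L zeta s v -> X 1 s v = developing_map zeta s v) /\
  exists (c xit : R -> R -> R3),
    forall t, 0 <= t <= 1 ->
      (origami_map L (fun s => zeta s - b) zeta (c t) (xit t) (fun _ => xi_check) (X t) \/
       unfolded_map L (fun s => zeta s - b) zeta (c t) (xit t) (fun _ => xi_check) (X t)) /\
      (forall s v, U b L zeta s v -> 0 <= v ->
         is_first_form L (ruled (c t) (xit t)) s v 1 (- Derive zeta s) 1) /\
      (forall s v, U b L zeta s v -> v <= 0 ->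
         is_first_form L (ruled (c t) (fun _ => xi_check)) s v 1 (- Derive zeta s) 1) /\
      on_x_axis (c t 0) /\ on_x_axis (c t L).

Definition crease_lm (zeta : R -> R) (l m : R) (s : R) : R3 :=
  (RInt (fun w => sqrt (1 - (1 + l ^ 2) * (Derive zeta w) ^ 2)) 0 s + m,
   zeta s, l * zeta s).

Definition xi_l (l : R) : R3 :=
  scal (/ (1 + l ^ 2)) ((0, l ^ 2 - 1, - (2 * l)) : R3).

Definition map_lm (zeta : R -> R) (l m : R) (s v : R) : R3 :=
  if Rle_dec 0 v then plus (crease_lm zeta l m s) (scal v (xi_l l))
  else plus (crease_lm zeta l m s) (scal v xi_check).

Definition admissible (L : R) (zeta lambda mu : R -> R) : Prop :=
  continuous_on (fun t => 0 <= t <= 1) lambda /\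
  continuous_on (fun t => 0 <= t <= 1) mu /\
  mu 0 = 0 /\ mu 1 = 0 /\ lambda 1 = 0 /\ lambda 0 = 1 /\
  (forall t s, 0 <= t <= 1 -> 0 < s < L ->
     (1 + (lambda t) ^ 2) * (Derive zeta s) ^ 2 < 1).

(* Main.v *)
Require Import Defs.
From Stdlib Require Import Reals Lra Lia Psatz.
From Coquelicot Require Import Coquelicot.
Open Scope R_scope.

(** With [A = sqrt (1 - (1 + l^2) zeta'^2)] and [m = sqrt (1 + l^2)], the crease with parameter
    [l] has Frenet frame [T = (A, zeta', l zeta')], [N = (m zeta', - A / m, - l A / m)],
    [B = (0, l / m, - 1 / m)], so that the rulings [xi_l l] and [xi_check] have angular functions
    [atan (l / A)] and [- atan (l / A)] and the common second angle [beta] with [cos beta = - zeta'].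

    Conversely, in a deformation the first form on [U_-] gives [y = zeta] along the crease, and the
    first form on [U_+] forces the ruling to be a constant unit vector [a].  Both rulings have inner
    product [- zeta'] with the tangent.  If [a <> xi_check], the crease lies in a plane orthogonal
    to [a - xi_check] which contains the x-axis, because its end points do; hence [z = l zeta], and
    this determines [a].  If [a = xi_check], the crease projects to a segment of the x-axis.  The
    sign of [x'] cannot change during the deformation, since the distance of the end points of the
    crease depends continuously on [t] and does not vanish. *)

(** The bound on [zeta'] is strict inside [(0, L)] but may become an equality at an end point, where
    [A] vanishes and need not be differentiable. Frames and second derivatives are therefore taken
    on the open interval only; identities reach [[0, L]] because a function continuous there with
    zero derivative inside is constant. For the same reason continuity in [t] rests on a Hoelder
    estimate of the integrand, not on differentiation in [lambda]. All frame formulas come from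
    [A^2 + m^2 zeta'^2 = 1]. Conversely, unit speed only yields [(1 + l^2) zeta'^2 <= 1]; strictness
    is a consequence of [zeta'' < 0]. In the converse, crease and ruling are given for each [t]
    separately, without continuity in [t]. Hence [lambda] and [mu] are read off the map itself:
    [lambda] from the height of the crease at [s = L / 2], where [zeta > 0], and [mu] from its
    initial point. At a single [t] all conditions are invariant under reflection in a plane
    orthogonal to the x-axis, so the sign of [x'] can only be settled by comparison with [t = 0]. *)

Lemma R3_eq (u w : R3) : px u = px w -> py u = py w -> pz u = pz w -> u = w.
Proof.
  destruct u as [[u1 u2] u3], w as [[w1 w2] w3]; unfold px, py, pz; simpl.
  now intros -> -> ->.
Qed.

Lemma px_plus u w : px (plus u w) = px u + px w. Proof. reflexivity. Qed.
Lemma py_plus u w : py (plus u w) = py u + py w. Proof. reflexivity. Qed.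
Lemma pz_plus u w : pz (plus u w) = pz u + pz w. Proof. reflexivity. Qed.
Lemma px_scal (k : R) (u : R3) : px (scal k u) = k * px u. Proof. reflexivity. Qed.
Lemma py_scal (k : R) (u : R3) : py (scal k u) = k * py u. Proof. reflexivity. Qed.
Lemma pz_scal (k : R) (u : R3) : pz (scal k u) = k * pz u. Proof. reflexivity. Qed.

(** * One-sided differentiation on [[0, L]] *)

Definition derive_in (L : R) (f : R -> R) (s l : R) : Prop :=
  filterdiff f (within (fun u => 0 <= u <= L) (locally s)) (fun h : R => scal h l).

(** [filterdiff] asks for the error estimate at every limit of the filter. A set of the filter
    contains [s], because [s] lies in the interval; so the ball about [x] of radius [|x - s|], which
    misses [s], cannot belong to it. *)
Lemma within_limit L s : 0 <= s <= L ->
  forall x, is_filter_lim (within (fun u => 0 <= u <= L) (locally s)) x -> x = s.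
Proof.
  intros Hs x Hx.
  destruct (Req_dec x s) as [E|E]; [exact E|exfalso].
  assert (Hp : 0 < Rabs (x - s)) by (apply Rabs_pos_lt; lra).
  specialize (Hx (fun y => Rabs (y - x) < Rabs (x - s))).
  unfold within in Hx.
  assert (Hl : locally x (fun y : R => Rabs (y - x) < Rabs (x - s))).
  { exists (mkposreal _ Hp). intros y Hy. exact Hy. }
  specialize (Hx Hl). apply locally_singleton in Hx. specialize (Hx Hs).
  rewrite Rabs_minus_sym in Hx. lra.
Qed.

Lemma within_is_limit L s : is_filter_lim (within (fun u => 0 <= u <= L) (locally s)) s.
Proof. intros P HP. unfold within. revert HP. apply filter_imp. auto. Qed.

Lemma within_proper L s : 0 <= s <= L ->
  ProperFilter (within (fun u => 0 <= u <= L) (locally s)).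
Proof.
  intros Hs. split.
  - intros P HP. exists s. apply locally_singleton in HP. auto.
  - apply within_filter, locally_filter.
Qed.

Lemma derive_in_iff L f s l : 0 <= s <= L ->
  derive_in L f s l <->
  forall eps : posreal, exists d : posreal, forall y, 0 <= y <= L -> Rabs (y - s) < d ->
    Rabs (f y - f s - (y - s) * l) <= eps * Rabs (y - s).
Proof.
  intros Hs. split.
  - intros [_ H] eps. specialize (H s (within_is_limit L s) eps).
    destruct H as [d Hd]. exists d. intros y Hy Hys. exact (Hd y Hys Hy).
  - intros H. split.
    + apply (is_linear_scal_l (V := R_NormedModule) l).
    + intros x Hx. apply (within_limit L s Hs) in Hx. subst x.
      intros eps. destruct (H eps) as [d Hd]. exists d. intros y Hys Hy.
      exact (Hd y Hy Hys).
Qed.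

Lemma is_derive_derive_in L f s l : 0 <= s <= L -> is_derive f s l -> derive_in L f s l.
Proof.
  intros Hs H.
  apply (filterdiff_locally (FF := within_proper L s Hs) f s); auto.
  apply within_is_limit.
Qed.

Lemma derive_in_ext L f g s l : 0 <= s <= L -> (forall y, 0 <= y <= L -> f y = g y) ->
  derive_in L f s l -> derive_in L g s l.
Proof.
  intros Hs E. rewrite !derive_in_iff by auto. intros H eps.
  destruct (H eps) as [d Hd]. exists d. intros y Hy Hys.
  rewrite <- !E by auto. auto.
Qed.

Lemma locally_open_interval (L s : R) (P : R -> Prop) : 0 < s < L ->
  (forall u, 0 < u < L -> P u) -> locally s P.
Proof.
  intros Hs H.
  assert (Hp : 0 < Rmin s (L - s)) by (apply Rmin_pos; lra).
  exists (mkposreal _ Hp). intros y Hy. apply H.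
  change (Rabs (y - s) < Rmin s (L - s)) in Hy. apply Rabs_def2 in Hy.
  pose proof (Rmin_l s (L - s)). pose proof (Rmin_r s (L - s)). lra.
Qed.

Lemma derive_in_is_derive L f s l : 0 < s < L -> derive_in L f s l -> is_derive f s l.
Proof.
  intros Hs [Hl H]. split; [exact Hl|].
  intros x Hx. assert (E : s = x) by (apply is_filter_lim_locally_unique; exact Hx).
  subst x. intros eps. specialize (H s (within_is_limit L s) eps).
  assert (Hn : locally s (fun y => 0 <= y <= L)).
  { apply (locally_open_interval L); [exact Hs|intros; lra]. }
  unfold within in H.
  generalize (filter_and _ _ H Hn). apply filter_imp. intros y [H1 H2]. auto.
Qed.

Lemma derive_in_unique L f s l1 l2 : 0 < L -> 0 <= s <= L ->
  derive_in L f s l1 -> derive_in L f s l2 -> l1 = l2.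
Proof.
  intros HL Hs. rewrite !derive_in_iff by auto. intros H1 H2.
  destruct (Req_dec l1 l2) as [E|E]; [exact E|exfalso].
  assert (Hp : 0 < Rabs (l1 - l2) / 4).
  { assert (0 < Rabs (l1 - l2)) by (apply Rabs_pos_lt; lra). lra. }
  destruct (H1 (mkposreal _ Hp)) as [d1 Hd1]. destruct (H2 (mkposreal _ Hp)) as [d2 Hd2].
  simpl in *.
  (* Since [e <= L / 2], one of [s + e] and [s - e] stays in [[0, L]], also when [s] is an end
     point. The two errors of a quarter then add up to half of [|l1 - l2|], which is too small. *)
  set (e := Rmin (Rmin d1 d2) L / 2).
  assert (He : 0 < e /\ e < d1 /\ e < d2 /\ e <= L / 2).
  { unfold e. pose proof (cond_pos d1). pose proof (cond_pos d2).
    assert (0 < Rmin (Rmin d1 d2) L) by (repeat apply Rmin_pos; auto).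
    pose proof (Rmin_l (Rmin d1 d2) L). pose proof (Rmin_r (Rmin d1 d2) L).
    pose proof (Rmin_l d1 d2). pose proof (Rmin_r d1 d2). lra. }
  assert (Hy : exists y, 0 <= y <= L /\ Rabs (y - s) = e).
  { destruct (Rle_dec s (L / 2)).
    - exists (s + e). split; [lra|]. rewrite Rabs_right; lra.
    - exists (s - e). split; [lra|]. rewrite Rabs_left; lra. }
  destruct Hy as [y [Hy Hye]].
  specialize (Hd1 y Hy). specialize (Hd2 y Hy). rewrite Hye in *.
  specialize (Hd1 ltac:(lra)). specialize (Hd2 ltac:(lra)).
  assert (K : Rabs ((y - s) * (l1 - l2)) <= Rabs (l1 - l2) / 4 * e + Rabs (l1 - l2) / 4 * e).
  { replace ((y - s) * (l1 - l2)) with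
      ((f y - f s - (y - s) * l2) - (f y - f s - (y - s) * l1)) by ring.
    eapply Rle_trans; [apply Rabs_triang|]. rewrite Rabs_Ropp. lra. }
  rewrite Rabs_mult, Hye in K. nra.
Qed.

Lemma derive_in_plus L f g s a b :
  derive_in L f s a -> derive_in L g s b -> derive_in L (fun u => f u + g u) s (a + b).
Proof.
  intros H1 H2. unfold derive_in.
  eapply filterdiff_ext_lin.
  - apply (filterdiff_plus_fct (FF := within_filter _ _ _ _) _ _ _ _ H1 H2).
  - intros y. unfold plus, scal; simpl; unfold mult; simpl. ring.
Qed.

Lemma derive_in_scal L f s a k :
  derive_in L f s a -> derive_in L (fun u => k * f u) s (k * a).
Proof.
  intros H1. unfold derive_in.
  eapply filterdiff_ext_lin.
  - apply (filterdiff_scal_r_fct (FF := within_filter _ _ _ _) k _ _ Rmult_comm H1).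
  - intros y. unfold scal; simpl; unfold mult; simpl. ring.
Qed.

Lemma derive_in_const L s a : derive_in L (fun _ => a) s 0.
Proof.
  unfold derive_in. eapply filterdiff_ext_lin.
  - apply (filterdiff_const (FF := within_filter _ _ _ _)).
  - intros y. unfold scal, zero; simpl; unfold mult; simpl. ring.
Qed.

Lemma filterdiff_linear_comp (U V W : NormedModule R_AbsRing) (F : (U -> Prop) -> Prop)
    {FF : Filter F} (g : V -> W) (f lf : U -> V) :
  is_linear g -> filterdiff f F lf -> filterdiff (fun x => g (f x)) F (fun x => g (lf x)).
Proof.
  intros Hg Hf. apply (filterdiff_comp f g lf g Hf).
  apply filterdiff_linear, Hg.
Qed.

Local Notation R3_module :=
  (prod_NormedModule R_AbsRing
     (prod_NormedModule R_AbsRing R_NormedModule R_NormedModule) R_NormedModule).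

(** One direction composes with the linear projections; the other reassembles [f] as the sum of its
    coordinates times the standard basis vectors. *)
Lemma filterdiff_R3 (F : (R -> Prop) -> Prop) {FF : Filter F} (f : R -> R3) (l : R3) :
  filterdiff f F (fun h : R => scal h l) <->
  filterdiff (fun u => px (f u)) F (fun h : R => scal h (px l)) /\
  filterdiff (fun u => py (f u)) F (fun h : R => scal h (py l)) /\
  filterdiff (fun u => pz (f u)) F (fun h : R => scal h (pz l)).
Proof.
  split.
  - intros H. split; [|split].
    + assert (Hg : is_linear (fun u : R3_module => fst (fst u))).
      { apply (is_linear_comp (fun u : R3_module => fst u) (fun u => fst u)); apply is_linear_fst. }
      exact (filterdiff_linear_comp _ _ _ _ _ _ _ Hg H).
    + assert (Hg : is_linear (fun u : R3_module => snd (fst u))).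
      { apply (is_linear_comp (fun u : R3_module => fst u) (fun u => snd u)); [apply is_linear_fst|apply is_linear_snd]. }
      exact (filterdiff_linear_comp _ _ _ _ _ _ _ Hg H).
    + assert (Hg : is_linear (fun u : R3_module => snd u))
        by apply is_linear_snd.
      exact (filterdiff_linear_comp _ _ _ _ _ _ _ Hg H).
  - intros (H1 & H2 & H3).
    pose proof (filterdiff_scal_l_fct (V := R3_module) ((1, 0, 0) : R3) _ _ H1) as K1.
    pose proof (filterdiff_scal_l_fct (V := R3_module) ((0, 1, 0) : R3) _ _ H2) as K2.
    pose proof (filterdiff_scal_l_fct (V := R3_module) ((0, 0, 1) : R3) _ _ H3) as K3.
    pose proof (filterdiff_plus_fct _ _ _ _ (filterdiff_plus_fct _ _ _ _ K1 K2) K3) as K.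
    eapply filterdiff_ext; [|eapply filterdiff_ext_lin; [exact K|]].
    + intros y. apply R3_eq; unfold px, py, pz, plus, scal; simpl; unfold plus, scal, mult; simpl; unfold mult; simpl; ring.
    + intros y. apply R3_eq; unfold px, py, pz, plus, scal; simpl; unfold plus, scal, mult; simpl; unfold mult; simpl; ring.
Qed.

Lemma is_derive_in_comps L f s l :
  is_derive_in L f s l <->
  derive_in L (fun u => px (f u)) s (px l) /\
  derive_in L (fun u => py (f u)) s (py l) /\
  derive_in L (fun u => pz (f u)) s (pz l).
Proof. apply filterdiff_R3, within_filter, locally_filter. Qed.

Lemma is_derive_R3_unique (f : R -> R3) x l1 l2 :
  is_derive f x l1 -> is_derive f x l2 -> l1 = l2.
Proof.
  intros H1 H2.
  apply (proj1 (filterdiff_R3 (locally x) f l1)) in H1.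
  apply (proj1 (filterdiff_R3 (locally x) f l2)) in H2.
  destruct H1 as (A1 & B1 & C1), H2 as (A2 & B2 & C2).
  apply R3_eq.
  - transitivity (Derive (fun u => px (f u)) x); [symmetry|]; apply is_derive_unique; assumption.
  - transitivity (Derive (fun u => py (f u)) x); [symmetry|]; apply is_derive_unique; assumption.
  - transitivity (Derive (fun u => pz (f u)) x); [symmetry|]; apply is_derive_unique; assumption.
Qed.

Lemma is_derive_in_unique L f s l1 l2 : 0 < L -> 0 <= s <= L ->
  is_derive_in L f s l1 -> is_derive_in L f s l2 -> l1 = l2.
Proof.
  intros HL Hs. rewrite !is_derive_in_comps. intros (?&?&?) (?&?&?).
  apply R3_eq; eapply derive_in_unique; eauto.
Qed.

(** * Continuity relative to a set *)

Lemma continuous_on_comps (T : UniformSpace) (D : T -> Prop) (f : T -> R3) :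
  continuous_on D f <->
  continuous_on D (fun x => px (f x)) /\
  continuous_on D (fun x => py (f x)) /\
  continuous_on D (fun x => pz (f x)).
Proof.
  split.
  - intros H. repeat split; intros x Hx; specialize (H x Hx).
    + refine (filterlim_comp _ _ _ f px _ _ _ H _).
      unfold px. apply (continuous_comp (fun u : R3 => fst u) fst); apply continuous_fst.
    + refine (filterlim_comp _ _ _ f py _ _ _ H _).
      unfold py. apply (continuous_comp (fun u : R3 => fst u) snd);
        [apply continuous_fst|apply continuous_snd].
    + refine (filterlim_comp _ _ _ f pz _ _ _ H _).
      unfold pz. apply continuous_snd.
  - intros (H1 & H2 & H3) x Hx. specialize (H1 x Hx). specialize (H2 x Hx). specialize (H3 x Hx).
    intros P [eps HP].
    specialize (H1 _ (locally_ball _ eps)). specialize (H2 _ (locally_ball _ eps)).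
    specialize (H3 _ (locally_ball _ eps)).
    unfold filtermap, within in *.
    generalize (filter_and _ _ H1 (filter_and _ _ H2 H3)). apply filter_imp.
    intros y (A & B & C) Dy. apply HP. repeat split; [apply A|apply B|apply C]; auto.
Qed.

Lemma continuous_on_px (T : UniformSpace) (D : T -> Prop) (f : T -> R3) :
  continuous_on D f -> continuous_on D (fun x => px (f x)).
Proof. intros H. apply (proj1 (continuous_on_comps T D f) H). Qed.

Lemma continuous_on_pz (T : UniformSpace) (D : T -> Prop) (f : T -> R3) :
  continuous_on D f -> continuous_on D (fun x => pz (f x)).
Proof. intros H. apply (proj1 (continuous_on_comps T D f) H). Qed.

(** The retraction of the line onto [[a, b]]. Composition with it turns continuity relative to the
    interval into continuity on the whole line, without changing values on the interval. *)
Definition clamp (a b x : R) : R := Rmax a (Rmin b x).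

Lemma clamp_in a b x : a <= b -> a <= clamp a b x <= b.
Proof.
  intros H. unfold clamp. split; [apply Rmax_l|].
  apply Rmax_lub; [auto|apply Rmin_l].
Qed.

Lemma clamp_id a b x : a <= x <= b -> clamp a b x = x.
Proof. intros H. unfold clamp. rewrite Rmin_right, Rmax_right; lra. Qed.

Lemma clamp_lip a b x y : a <= b -> Rabs (clamp a b x - clamp a b y) <= Rabs (x - y).
Proof.
  intros H. unfold clamp, Rmax, Rmin.
  repeat (destruct (Rle_dec _ _)); unfold Rabs; repeat (destruct (Rcase_abs _)); lra.
Qed.

Lemma continuous_clamp (f : R -> R) a b : a <= b ->
  continuous_on (fun x => a <= x <= b) f -> forall x, continuous (fun u => f (clamp a b u)) x.
Proof.
  intros Hab Hf x P HP.
  specialize (Hf (clamp a b x) (clamp_in a b x Hab) P HP).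
  destruct Hf as [d Hd]. exists d. intros y Hy. unfold filtermap.
  apply Hd; [|apply clamp_in; auto].
  eapply Rle_lt_trans; [apply (clamp_lip a b y x Hab)|exact Hy].
Qed.

Lemma continuous_continuous_on (U V : UniformSpace) (D : U -> Prop) (f : U -> V) :
  (forall x, D x -> continuous f x) -> continuous_on D f.
Proof. intros H x Hx. exact (filterlim_filter_le_1 f (filter_le_within (F := locally x) D) (H x Hx)). Qed.

Lemma continuous_on_plus (T : UniformSpace) (D : T -> Prop) (f g : T -> R) :
  continuous_on D f -> continuous_on D g -> continuous_on D (fun x => f x + g x).
Proof.
  intros Hf Hg x Hx.
  exact (filterlim_comp_2 _ _ _ (Hf x Hx) (Hg x Hx) (filterlim_plus (V := R_NormedModule) (f x) (g x))).
Qed.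

Lemma continuous_on_mult (T : UniformSpace) (D : T -> Prop) (f g : T -> R) :
  continuous_on D f -> continuous_on D g -> continuous_on D (fun x => f x * g x).
Proof.
  intros Hf Hg x Hx.
  exact (filterlim_comp_2 _ _ _ (Hf x Hx) (Hg x Hx) (filterlim_mult (K := R_AbsRing) (f x) (g x))).
Qed.

Lemma continuous_on_const (T : UniformSpace) (D : T -> Prop) (a : R) :
  continuous_on D (fun _ => a).
Proof. apply continuous_continuous_on. intros. apply continuous_const. Qed.

Lemma continuous_on_compose (T V W : UniformSpace) (D : T -> Prop) (E : V -> Prop)
    (f : T -> V) (g : V -> W) :
  continuous_on D f -> continuous_on E g -> (forall x, D x -> E (f x)) ->
  continuous_on D (fun x => g (f x)).
Proof.
  intros Hf Hg HE x Hx P HP.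
  pose proof (Hf x Hx _ (Hg (f x) (HE x Hx) P HP)) as H.
  unfold filtermap, within in *. revert H. apply filter_imp. auto.
Qed.

Lemma continuous_on_postcompose (T : UniformSpace) (D : T -> Prop) (f : T -> R) (g : R -> R) :
  continuous_on D f -> (forall y, continuous g y) -> continuous_on D (fun x => g (f x)).
Proof.
  intros Hf Hg. apply (continuous_on_compose _ _ _ D (fun _ => True)); auto.
  apply continuous_continuous_on. auto.
Qed.

Lemma derive_in_continuous L f s l : derive_in L f s l ->
  filterlim f (within (fun u => 0 <= u <= L) (locally s)) (locally (f s)).
Proof.
  intros H. apply (filterdiff_continuous_aux (FF := within_filter _ _ _ _) f).
  - eexists; exact H.
  - apply within_is_limit.
Qed.

(** * Mean values, intermediate values and integrals on a closed interval *)

Lemma MVT_in (L : R) (f f' : R -> R) :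
  continuous_on (fun s => 0 <= s <= L) f ->
  (forall s, 0 < s < L -> is_derive f s (f' s)) ->
  forall a b, 0 <= a -> a < b -> b <= L ->
  exists c, a < c < b /\ f b - f a = f' c * (b - a).
Proof.
  intros Hc Hd a b Ha Hab Hb.
  set (g := fun x => f (clamp 0 L x)).
  assert (Hg : forall c, a < c < b -> derivable_pt_lim g c (f' c)).
  { intros c Hc'. apply is_derive_Reals.
    apply is_derive_ext_loc with f; [|apply Hd; lra].
    assert (Hp : 0 < Rmin (c - a) (b - c)) by (apply Rmin_pos; lra).
    exists (mkposreal _ Hp). intros y Hy.
    change (Rabs (y - c) < Rmin (c - a) (b - c)) in Hy. apply Rabs_def2 in Hy.
    pose proof (Rmin_l (c - a) (b - c)). pose proof (Rmin_r (c - a) (b - c)).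
    unfold g. rewrite clamp_id by lra. reflexivity. }
  destruct (MVT g id a b (fun c P => exist _ (f' c) (Hg c P))
     (fun c _ => derivable_pt_id c) Hab) as [c [P E]].
  - intros c _. apply continuity_pt_filterlim. apply continuous_clamp; auto; lra.
  - intros c _. apply derivable_continuous_pt, derivable_pt_id.
  - exists c. split; [exact P|].
    rewrite derive_pt_id in E. simpl in E. unfold g, id in E.
    rewrite !clamp_id in E by lra. lra.
Qed.

Lemma zero_derive_const L (f f' : R -> R) :
  continuous_on (fun s => 0 <= s <= L) f ->
  (forall s, 0 < s < L -> is_derive f s (f' s)) ->
  (forall s, 0 < s < L -> f' s = 0) ->
  forall s, 0 <= s <= L -> f s = f 0.
Proof.
  intros Hc Hd H0 s Hs. destruct (Req_dec s 0) as [->|N]; [reflexivity|].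
  destruct (MVT_in L f f' Hc Hd 0 s) as [c [Hc' E]]; try lra.
  rewrite H0 in E by lra. lra.
Qed.

(** A change of sign would produce a zero by the intermediate value theorem. The minimum and maximum
    leave the order of [p] and [q] open, so a sign can be carried in either direction. *)
Lemma sign_constant a b (g : R -> R) :
  a <= b -> continuous_on (fun x => a <= x <= b) g ->
  forall p q, a <= p <= b -> a <= q <= b ->
  (forall x, Rmin p q <= x <= Rmax p q -> g x <> 0) -> 0 < g p -> 0 < g q.
Proof.
  intros Hab Hc p q Hp Hq Hn Hgp.
  destruct (Rlt_dec 0 (g q)) as [|N]; [auto|exfalso].
  destruct (IVT_gen_consistent (fun x => g (clamp a b x)) p q 0) as [x [Hx E]].
  - apply continuous_clamp; auto.
  - rewrite !clamp_id by auto. rewrite Rmin_right, Rmax_left; lra.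
  - apply (Hn x Hx). rewrite clamp_id in E; auto.
    pose proof (Rmin_glb p q a ltac:(lra) ltac:(lra)).
    pose proof (Rmax_lub p q b ltac:(lra) ltac:(lra)). lra.
Qed.

Lemma derive_in_RInt L (A : R -> R) s : 0 <= s <= L ->
  (forall w, 0 <= w <= L -> continuous A w) ->
  derive_in L (fun u => RInt A 0 u) s (A s).
Proof.
  intros Hs HA.
  (* Nothing is known about [A] off [[0, L]]; the clamped integrand has the same integrals from 0 to
     points of [[0, L]] and is continuous everywhere. *)
  set (B := fun x => A (clamp 0 L x)).
  assert (HB : forall x, continuous B x).
  { apply continuous_clamp; [lra|]. apply continuous_continuous_on, HA. }
  apply derive_in_ext with (fun u => RInt B 0 u); auto.
  - intros y Hy. apply RInt_ext. intros x. rewrite Rmin_left, Rmax_right by lra.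
    intros Hx. unfold B. rewrite clamp_id; [reflexivity|lra].
  - replace (A s) with (B s) by (unfold B; rewrite clamp_id; auto).
    apply is_derive_derive_in; auto.
    apply is_derive_RInt with 0; auto.
    apply filter_forall. intros y. apply (RInt_correct (V := R_CompleteNormedModule)).
    apply (ex_RInt_continuous (V := R_CompleteNormedModule)); auto.
Qed.

(** Differentiability of order [n] as a tower of successive derivatives, with no condition at
    [n = 0]. Each derivative is any witness valid on [(0, L)], so closure under algebraic operations
    follows by induction from the first-order rules alone. *)
Fixpoint Ck (L : R) (n : nat) (f : R -> R) : Prop :=
  match n with
  | O => True
  | S m => exists f', (forall s, 0 < s < L -> is_derive f s (f' s)) /\ Ck L m f'
  end.

Lemma Ck_pred L n f : Ck L (S n) f -> Ck L n f.
Proof.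
  revert f; induction n as [|n IH]; intros f; simpl; auto.
  intros (f' & H & K). exists f'. split; auto.
Qed.

Lemma Ck_ext L n f g : (forall s, 0 < s < L -> f s = g s) -> Ck L n f -> Ck L n g.
Proof.
  destruct n; simpl; auto. intros E (f' & H & K). exists f'. split; auto.
  intros s Hs. apply is_derive_ext_loc with f; auto. apply (locally_open_interval L); auto.
Qed.

Lemma Derive_n_S f n x : Derive_n f (S n) x = Derive_n (Derive f) n x.
Proof.
  change (Derive f) with (Derive_n f 1). rewrite Derive_n_comp. f_equal. lia.
Qed.

(** [Derive_n] adds derivatives on the outside, whereas [Ck] peels them off from the inside;
    [Derive_n_S] exchanges the two. *)
Lemma smooth_open_Ck L f : smooth_open L f <-> forall n, Ck L n f.
Proof.
  split.
  - intros H n; revert f H. induction n as [|n IH]; intros f H; simpl; auto.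
    exists (Derive f). split.
    + intros s Hs. apply Derive_correct. exact (H 1%nat s Hs).
    + apply IH. intros [|m] s Hs; simpl; auto.
      apply ex_derive_ext with (Derive_n f (S m)); [|exact (H (S (S m)) s Hs)].
      intros t. apply Derive_n_S.
  - intros H n s Hs. specialize (H n). revert f H s Hs.
    induction n as [|n IH]; intros f H s Hs; [exact I|].
    destruct H as (f' & Hd & K).
    destruct n as [|n]; [exists (f' s); apply Hd, Hs|].
    simpl. apply ex_derive_ext with (Derive_n (Derive f) n).
    { intros t. symmetry. apply Derive_n_S. }
    change (ex_derive_n (Derive f) (S n) s).
    apply ex_derive_n_ext_loc with f'; [|apply IH; auto].
    apply (locally_open_interval L); auto. intros u Hu. symmetry.
    apply is_derive_unique, Hd, Hu.
Qed.

Lemma Ck_const L n a : Ck L n (fun _ => a).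
Proof.
  revert a; induction n; intros a; simpl; auto. exists (fun _ => 0). split; auto.
  intros s _. apply (is_derive_const a).
Qed.

Lemma Ck_plus L n f g : Ck L n f -> Ck L n g -> Ck L n (fun s => f s + g s).
Proof.
  revert f g; induction n; intros f g; simpl; auto.
  intros (f' & Hf & Kf) (g' & Hg & Kg). exists (fun s => f' s + g' s). split; auto.
  intros s Hs. apply (is_derive_plus f g); auto.
Qed.

(** The product rule contains [f] and [g] themselves at the lower order, which is what [Ck_pred]
    supplies. *)
Lemma Ck_mult L n f g : Ck L n f -> Ck L n g -> Ck L n (fun s => f s * g s).
Proof.
  revert f g; induction n; intros f g; auto.
  intros Hf0 Hg0. pose proof (Ck_pred _ _ _ Hf0). pose proof (Ck_pred _ _ _ Hg0).
  destruct Hf0 as (f' & Hf & Kf), Hg0 as (g' & Hg & Kg).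
  exists (fun s => f' s * g s + f s * g' s). split.
  - intros s Hs. apply (is_derive_mult f g); auto. intros; apply Rmult_comm.
  - apply Ck_plus; auto.
Qed.

(** The derivative is a polynomial in [f'] and [/ f], so the induction hypothesis for [/ f] closes
    the step. The square root below is treated in the same way, through [f' / (2 sqrt f)]. *)
Lemma Ck_inv L n f : (forall s, 0 < s < L -> f s <> 0) -> Ck L n f -> Ck L n (fun s => / f s).
Proof.
  intros N. induction n; auto.
  intros Hf0. pose proof (Ck_pred _ _ _ Hf0) as Hf1. destruct Hf0 as (f' & Hf & Kf).
  exists (fun s => -1 * f' s * (/ f s * / f s)). split.
  - intros s Hs. specialize (N s Hs). auto_derive.
    + split; [eexists; apply Hf; auto|auto].
    + replace (Derive (fun x => f x) s) with (f' s)
        by (symmetry; apply is_derive_unique, Hf, Hs).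
      field; auto.
  - repeat apply Ck_mult; auto. apply Ck_const.
Qed.

Lemma Ck_sqrt L n f : (forall s, 0 < s < L -> 0 < f s) -> Ck L n f -> Ck L n (fun s => sqrt (f s)).
Proof.
  intros N. induction n; auto.
  intros Hf0. pose proof (Ck_pred _ _ _ Hf0) as Hf1. destruct Hf0 as (f' & Hf & Kf).
  exists (fun s => f' s * / 2 * / sqrt (f s)). split.
  - intros s Hs. specialize (N s Hs). pose proof (sqrt_lt_R0 _ N).
    replace (f' s * / 2 * / sqrt (f s)) with (f' s / (2 * sqrt (f s))) by (field; lra).
    apply is_derive_sqrt; auto.
  - repeat apply Ck_mult; auto. { apply Ck_const. }
    apply Ck_inv; auto. intros s Hs. pose proof (sqrt_lt_R0 _ (N s Hs)). lra.
Qed.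

Lemma Ck_atan L n f : Ck L n f -> Ck L n (fun s => atan (f s)).
Proof.
  destruct n; auto. intros Hf0. pose proof (Ck_pred _ _ _ Hf0) as Hf1.
  destruct Hf0 as (f' & Hf & Kf).
  exists (fun s => f' s * / (1 + f s * f s)). split.
  - intros s Hs. apply (is_derive_comp atan f); [apply is_derive_atan|apply Hf, Hs].
  - apply Ck_mult; auto. apply Ck_inv; [intros s _; nra|].
    apply Ck_plus; [apply Ck_const|apply Ck_mult; auto].
Qed.

Lemma Ck_primitive L n f f' : (forall s, 0 < s < L -> is_derive f s (f' s)) ->
  Ck L n f' -> Ck L n f.
Proof. intros H K. apply Ck_pred. exists f'; auto. Qed.

(** * The crease with parameter l *)

Lemma enorm_eq u k : 0 <= k -> dot u u = k * k -> enorm u = k.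
Proof. intros Hk E. unfold enorm. rewrite E. apply sqrt_square, Hk. Qed.

Lemma dot_self_nonneg u : 0 <= dot u u.
Proof. unfold dot. nra. Qed.

Lemma dot_self_enorm u : dot u u = enorm u * enorm u.
Proof. unfold enorm. rewrite sqrt_sqrt; [reflexivity|apply dot_self_nonneg]. Qed.

Lemma dot_cross_cross u w :
  dot (cross u w) (cross u w) = dot u u * dot w w - dot u w * dot u w.
Proof. unfold dot, cross, px, py, pz; simpl. ring. Qed.

(** A right triangle with legs [d] and [n] and hypotenuse [h]; naming the hypotenuse keeps nested
    square roots out of later computations. *)
Lemma cos_sin_atan_ratio n d h : 0 < d -> 0 < h -> h * h = n * n + d * d ->
  cos (atan (n / d)) = d / h /\ sin (atan (n / d)) = n / h.
Proof.
  intros Hd Hh E. rewrite cos_atan, sin_atan.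
  replace (sqrt (1 + (n / d)²)) with (h / d).
  - split; field; lra.
  - symmetry. unfold Rsqr. replace (1 + n / d * (n / d)) with ((h / d) * (h / d)).
    + apply sqrt_square. apply Rlt_le, Rdiv_lt_0_compat; auto.
    + replace (h / d * (h / d)) with ((h * h) / (d * d)) by (field; lra).
      rewrite E. field; lra.
Qed.

Definition slope_bound (L : R) (zeta : R -> R) (l : R) : Prop :=
  forall s, 0 < s < L -> (1 + l ^ 2) * (Derive zeta s) ^ 2 < 1.

Definition speed (zeta : R -> R) (l w : R) : R :=
  sqrt (1 - (1 + l ^ 2) * (Derive zeta w) ^ 2).

Definition crease_velocity (zeta : R -> R) (l s : R) : R3 :=
  (speed zeta l s, Derive zeta s, l * Derive zeta s).

Lemma fundamental_derive b L zeta : fundamental_data b L zeta ->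
  forall s, 0 <= s <= L -> is_derive zeta s (Derive zeta s).
Proof. intros (_ & _ & H & _) s Hs. apply Derive_correct, (H 1%nat s Hs). Qed.

Lemma fundamental_continuous b L zeta : fundamental_data b L zeta ->
  forall s, 0 <= s <= L -> continuous (Derive zeta) s.
Proof.
  intros (_ & _ & H & _) s Hs. apply (ex_derive_continuous (Derive zeta)).
  exact (H 2%nat s Hs).
Qed.

Lemma fundamental_derive2 b L zeta : fundamental_data b L zeta ->
  forall s, 0 <= s <= L -> is_derive (Derive zeta) s (Derive_n zeta 2 s).
Proof. intros (_ & _ & H & _) s Hs. apply Derive_correct, (H 2%nat s Hs). Qed.

Lemma fundamental_smooth b L zeta : fundamental_data b L zeta -> smooth_open L zeta.
Proof. intros (_ & _ & H & _) n s Hs. apply H. lra. Qed.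

Lemma fundamental_Ck b L zeta : fundamental_data b L zeta ->
  forall n, Ck L n zeta /\ Ck L n (Derive zeta).
Proof.
  intros H n. split.
  - apply smooth_open_Ck, (fundamental_smooth b), H.
  - pose proof (proj1 (smooth_open_Ck L zeta) (fundamental_smooth _ _ _ H) (S n)) as (f' & Hf & K).
    apply Ck_ext with f'; auto. intros s Hs. symmetry. apply is_derive_unique, Hf, Hs.
Qed.

(** Continuity of [zeta'] carries the bound to the end points in weak form. If [g] were positive at
    [s], it would have no zero between [s] and the midpoint, being negative in the interior, and so
    would be positive at the midpoint. *)
Lemma slope_bound_closed b L zeta l : fundamental_data b L zeta -> slope_bound L zeta l ->
  forall s, 0 <= s <= L -> (1 + l ^ 2) * (Derive zeta s) ^ 2 <= 1.
Proof.
  intros Hf Hl s Hs.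
  assert (HL : 0 < L) by apply Hf.
  apply Rnot_lt_le. intros Hc.
  set (g := fun x => (1 + l ^ 2) * (Derive zeta x * Derive zeta x) - 1).
  assert (Hneg : forall x, 0 < x < L -> g x < 0).
  { intros x Hx. specialize (Hl x Hx). unfold g. simpl in Hl |- *. lra. }
  assert (Hps : 0 < g s) by (unfold g; simpl in Hc |- *; lra).
  assert (0 < g (L / 2)); [|pose proof (Hneg (L / 2) ltac:(lra)); lra].
  apply (sign_constant 0 L g) with s; try lra.
  - apply continuous_continuous_on. intros x Hx. unfold g.
    apply (continuous_minus (V := R_NormedModule)); [|apply continuous_const].
    apply (continuous_scal_r (V := R_NormedModule)).
    apply (continuous_mult (K := R_AbsRing)); apply (fundamental_continuous b L); auto.
  - intros x Hx. destruct (Req_dec x s) as [->|N]; [lra|].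
    assert (0 < x < L); [|pose proof (Hneg x ltac:(lra)); lra].
    unfold Rmin, Rmax in Hx. destruct (Rle_dec s (L / 2)); lra.
Qed.

(** [sqrt] is 0 on negative reals and continuous on the whole line, so a zero of the radicand at an
    end point is harmless for continuity. *)
Lemma continuous_speed b L zeta l : fundamental_data b L zeta ->
  forall s, 0 <= s <= L -> continuous (speed zeta l) s.
Proof.
  intros Hf s Hs. unfold speed. apply continuous_sqrt_comp.
  apply (continuous_minus (V := R_NormedModule)); [apply continuous_const|].
  apply (continuous_scal_r (V := R_NormedModule)).
  apply continuous_ext with (fun u => Derive zeta u * Derive zeta u); [intros; simpl; ring|].
  apply (continuous_mult (K := R_AbsRing)); apply (fundamental_continuous b L); auto.
Qed.

Lemma speed_pos L zeta l : slope_bound L zeta l -> forall s, 0 < s < L -> 0 < speed zeta l s.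
Proof. intros H s Hs. apply sqrt_lt_R0. specialize (H s Hs). lra. Qed.

Lemma speed_sqr zeta l s : (1 + l ^ 2) * (Derive zeta s) ^ 2 <= 1 ->
  speed zeta l s * speed zeta l s = 1 - (1 + l ^ 2) * (Derive zeta s) ^ 2.
Proof. intros H. unfold speed. apply sqrt_sqrt. lra. Qed.

Lemma crease_lm_derive b L zeta l m : fundamental_data b L zeta ->
  forall s, 0 <= s <= L -> is_derive_in L (crease_lm zeta l m) s (crease_velocity zeta l s).
Proof.
  intros Hf s Hs. apply is_derive_in_comps.
  unfold crease_lm, crease_velocity, px, py, pz; simpl. split; [|split].
  - rewrite <- (Rplus_0_r (speed zeta l s)). apply derive_in_plus; [|apply derive_in_const].
    apply (derive_in_RInt L (speed zeta l)); auto. apply (continuous_speed b); auto.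
  - apply is_derive_derive_in; auto. apply (fundamental_derive b L); auto.
  - apply derive_in_scal. apply is_derive_derive_in; auto. apply (fundamental_derive b L); auto.
Qed.

Lemma crease_velocity_continuous b L zeta l : fundamental_data b L zeta ->
  continuous_on (fun s => 0 <= s <= L) (crease_velocity zeta l).
Proof.
  intros Hf. apply continuous_on_comps. unfold crease_velocity, px, py, pz; simpl.
  split; [|split]; apply continuous_continuous_on; intros s Hs.
  - apply (continuous_speed b L); auto.
  - apply (fundamental_continuous b L); auto.
  - apply (continuous_scal_r (V := R_NormedModule)), (fundamental_continuous b L); auto.
Qed.

Lemma crease_velocity_unit b L zeta l : fundamental_data b L zeta -> slope_bound L zeta l ->
  forall s, 0 <= s <= L -> dot (crease_velocity zeta l s) (crease_velocity zeta l s) = 1.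
Proof.
  intros Hf Hl s Hs. pose proof (slope_bound_closed _ _ _ _ Hf Hl s Hs) as H.
  pose proof (speed_sqr _ _ _ H) as E.
  unfold dot, crease_velocity, px, py, pz; simpl in *. rewrite E. ring.
Qed.

Lemma is_derive_comps_of_in L c s T : 0 < s < L -> is_derive_in L c s T ->
  is_derive (fun u => px (c u)) s (px T) /\
  is_derive (fun u => py (c u)) s (py T) /\
  is_derive (fun u => pz (c u)) s (pz T).
Proof.
  intros Hs H. apply is_derive_in_comps in H. destruct H as (H1 & H2 & H3).
  split; [|split]; eapply derive_in_is_derive; eauto.
Qed.

Lemma DeriveV_of_in L c s T : 0 < s < L -> is_derive_in L c s T -> DeriveV c s = T.
Proof.
  intros Hs H. destruct (is_derive_comps_of_in _ _ _ _ Hs H) as (H1 & H2 & H3).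
  apply R3_eq; apply is_derive_unique; assumption.
Qed.

Lemma speed_derive b L zeta l : fundamental_data b L zeta -> slope_bound L zeta l ->
  forall s, 0 < s < L ->
  is_derive (speed zeta l) s (- ((1 + l ^ 2) * Derive zeta s * Derive_n zeta 2 s) / speed zeta l s).
Proof.
  intros Hf Hl s Hs. pose proof (speed_pos _ _ _ Hl s Hs) as HA. unfold speed in *.
  replace (- ((1 + l ^ 2) * Derive zeta s * Derive_n zeta 2 s) /
      sqrt (1 - (1 + l ^ 2) * Derive zeta s ^ 2))
    with ((- (2 * (1 + l ^ 2) * Derive zeta s * Derive_n zeta 2 s)) /
       (2 * sqrt (1 - (1 + l ^ 2) * Derive zeta s ^ 2))) by (field; lra).
  apply (is_derive_sqrt (fun u => 1 - (1 + l ^ 2) * Derive zeta u ^ 2)).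
  - pose proof (fundamental_derive2 _ _ _ Hf s ltac:(lra)) as H2.
    auto_derive; [eexists; exact H2|].
    replace (Derive (fun x => Derive zeta x) s) with (Derive_n zeta 2 s) by reflexivity.
    simpl. ring.
  - specialize (Hl s Hs). lra.
Qed.

(** With [P = zeta'] and [Q = zeta''], differentiation of [T] gives [T' = (- M^2 P Q / A, Q, l Q)],
    whose length is [- Q M / A] by [A^2 + M^2 P^2 = 1]. The sign of [Q] makes the curvature positive
    and turns the y-component of [N] negative. *)
Lemma crease_lm_frame b L zeta l m : fundamental_data b L zeta -> slope_bound L zeta l ->
  forall s, 0 < s < L ->
  Tvec (crease_lm zeta l m) s = crease_velocity zeta l s /\
  0 < kappa (crease_lm zeta l m) s /\
  Nvec (crease_lm zeta l m) s =
    (sqrt (1 + l ^ 2) * Derive zeta s, - speed zeta l s / sqrt (1 + l ^ 2),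
     - (l * speed zeta l s) / sqrt (1 + l ^ 2)) /\
  Bvec (crease_lm zeta l m) s = (0, l / sqrt (1 + l ^ 2), - 1 / sqrt (1 + l ^ 2)).
Proof.
  intros Hf Hl s Hs.
  assert (HT : forall u, 0 < u < L -> Tvec (crease_lm zeta l m) u = crease_velocity zeta l u).
  { intros u Hu. apply (DeriveV_of_in L); auto. apply (crease_lm_derive b); auto. lra. }
  pose proof (speed_pos _ _ _ Hl s Hs) as HA.
  pose proof (speed_sqr _ _ _ (Rlt_le _ _ (Hl s Hs))) as EA.
  set (M := sqrt (1 + l ^ 2)).
  assert (HM : 0 < M) by (apply sqrt_lt_R0; nra).
  assert (EM : M * M = 1 + l ^ 2) by (apply sqrt_sqrt; nra).
  assert (HQ : Derive_n zeta 2 s < 0) by (apply Hf; auto).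
  set (A := speed zeta l s) in *. set (P := Derive zeta s) in *.
  set (Q := Derive_n zeta 2 s) in *.
  assert (EA' : A * A + M * M * P * P = 1) by (rewrite EA, EM; ring).
  assert (HTT : DeriveV (Tvec (crease_lm zeta l m)) s =
            (- ((1 + l ^ 2) * P * Q) / A, Q, l * Q)).
  { assert (HLoc : locally s (fun u => crease_velocity zeta l u = Tvec (crease_lm zeta l m) u)).
    { apply (locally_open_interval L); auto. intros u Hu. symmetry; auto. }
    unfold DeriveV. apply f_equal2; [apply f_equal2|]; apply is_derive_unique.
    - apply is_derive_ext_loc with (fun u => px (crease_velocity zeta l u)).
      + revert HLoc. apply filter_imp. intros u ->. reflexivity.
      + apply (speed_derive b L); auto.
    - apply is_derive_ext_loc with (fun u => py (crease_velocity zeta l u)).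
      + revert HLoc. apply filter_imp. intros u ->. reflexivity.
      + apply (fundamental_derive2 b L); auto. lra.
    - apply is_derive_ext_loc with (fun u => pz (crease_velocity zeta l u)).
      + revert HLoc. apply filter_imp. intros u ->. reflexivity.
      + apply (is_derive_scal (Derive zeta)). apply (fundamental_derive2 b L); auto. lra. }
  assert (HK : kappa (crease_lm zeta l m) s = - Q * M / A).
  { unfold kappa. rewrite HTT. apply enorm_eq.
    - apply Rlt_le, Rdiv_lt_0_compat; [nra|auto].
    - unfold dot, px, py, pz; cbn [fst snd].
      rewrite <- EM.
      transitivity (Q * Q * (M * M) * (A * A + M * M * P * P) / (A * A)).
      + replace (- (M * M * P * Q) / A * (- (M * M * P * Q) / A) + Q * Q + l * Q * (l * Q))
          with (- (M * M * P * Q) / A * (- (M * M * P * Q) / A) + Q * Q * (1 + l ^ 2)) by ring.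
        rewrite <- EM. field. lra.
      + rewrite EA'. field. lra. }
  assert (HN : Nvec (crease_lm zeta l m) s = (M * P, - A / M, - (l * A) / M)).
  { unfold Nvec. rewrite HK, HTT, <- EM.
    apply R3_eq; rewrite ?px_scal, ?py_scal, ?pz_scal; unfold px, py, pz; cbn [fst snd];
      field; repeat split; lra. }
  split; [|split; [|split]]; auto.
  - rewrite HK. apply Rdiv_lt_0_compat; [nra|auto].
  - unfold Bvec. rewrite HN, HT by auto.
    unfold cross, crease_velocity, px, py, pz; cbn [fst snd]. fold A P.
    apply f_equal2; [apply f_equal2|].
    + field. lra.
    + transitivity (l * (A * A + M * M * P * P) / M); [field; lra|]. rewrite EA'. field; lra.
    + transitivity (- (A * A + M * M * P * P) / M); [field; lra|]. rewrite EA'. field; lra.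
Qed.

Lemma speed_Ck b L zeta l : fundamental_data b L zeta -> slope_bound L zeta l ->
  forall n, Ck L n (speed zeta l).
Proof.
  intros Hf Hl n. apply Ck_sqrt.
  - intros s Hs. specialize (Hl s Hs). lra.
  - pose proof (proj2 (fundamental_Ck b L zeta Hf n)).
    apply Ck_ext with (fun s => 1 + -1 * (1 + l ^ 2) * (Derive zeta s * Derive zeta s));
      [intros; simpl; ring|].
    apply Ck_plus; [apply Ck_const|].
    repeat apply Ck_mult; auto; apply Ck_const.
Qed.

Lemma increasing_inj L f f' :
  continuous_on (fun s => 0 <= s <= L) f ->
  (forall s, 0 < s < L -> is_derive f s (f' s)) ->
  (forall s, 0 < s < L -> 0 < f' s) ->
  forall s s', 0 <= s <= L -> 0 <= s' <= L -> f s = f s' -> s = s'.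
Proof.
  intros Hc Hd Hp.
  assert (K : forall s s', 0 <= s -> s < s' -> s' <= L -> f s < f s').
  { intros s s' H1 H2 H3. destruct (MVT_in L f f' Hc Hd s s') as [c [Hc' E]]; auto.
    specialize (Hp c ltac:(lra)). nra. }
  intros s s' Hs Hs' E.
  destruct (Rtotal_order s s') as [H|[H|H]]; auto; exfalso.
  - specialize (K s s' ltac:(lra) H ltac:(lra)). lra.
  - specialize (K s' s ltac:(lra) H ltac:(lra)). lra.
Qed.

Lemma crease_lm_px_inj b L zeta l m : fundamental_data b L zeta -> slope_bound L zeta l ->
  forall s s', 0 <= s <= L -> 0 <= s' <= L ->
  px (crease_lm zeta l m s) = px (crease_lm zeta l m s') -> s = s'.
Proof.
  intros Hf Hl. pose proof (crease_lm_derive b L zeta l m Hf) as Hd.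
  apply (increasing_inj L (fun u => px (crease_lm zeta l m u)) (speed zeta l)).
  - intros u Hu.
    apply (derive_in_continuous L (fun u => px (crease_lm zeta l m u)) u (speed zeta l u)).
    apply (proj1 (is_derive_in_comps _ _ _ _) (Hd u Hu)).
  - intros u Hu. apply (is_derive_comps_of_in L _ _ _ Hu (Hd u ltac:(lra))).
  - apply speed_pos, Hl.
Qed.

Lemma crease_lm_is_crease b L zeta l m : fundamental_data b L zeta -> slope_bound L zeta l ->
  is_crease L (crease_lm zeta l m).
Proof.
  intros Hf Hl. assert (HL : 0 < L) by apply Hf.
  pose proof (crease_lm_derive b L zeta l m Hf) as Hd.
  split; [|split; [|split; [|split]]].
  - exists (crease_velocity zeta l). split; auto. apply (crease_velocity_continuous b L); auto.
  - pose proof (speed_Ck b L zeta l Hf Hl) as HC.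
    split; [|split]; apply smooth_open_Ck; intros n.
    + apply Ck_primitive with (speed zeta l); auto.
      intros s Hs. apply (is_derive_comps_of_in L _ _ _ Hs (Hd s ltac:(lra))).
    + apply (fundamental_Ck b); auto.
    + apply (Ck_mult L n (fun _ => l)); [apply Ck_const|apply (fundamental_Ck b); auto].
  - intros s v Hs Hv. rewrite (is_derive_in_unique _ _ _ _ _ HL Hs Hv (Hd s Hs)).
    apply enorm_eq; [lra|]. rewrite (crease_velocity_unit b L); auto. ring.
  - intros s s' Hs Hs' E. apply (crease_lm_px_inj b L zeta l m); auto. now rewrite E.
  - intros s Hs. apply (crease_lm_frame b L zeta l m Hf Hl s Hs).
Qed.

(** * Derivatives and curvature of ruled surfaces, and the two constant rulings *)

Lemma is_derive_affine (a k v : R) : is_derive (fun u => a + u * k) v k.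
Proof. auto_derive; [exact I|ring]. Qed.

Lemma is_derive_ruled_v c eta s v : is_derive (ruled c eta s) v (eta s).
Proof.
  apply (proj2 (filterdiff_R3 (locally v) (ruled c eta s) (eta s))).
  split; [|split].
  - apply (is_derive_affine (px (c s)) (px (eta s))).
  - apply (is_derive_affine (py (c s)) (py (eta s))).
  - apply (is_derive_affine (pz (c s)) (pz (eta s))).
Qed.

Lemma ruled_derive_in L c eta s v T eta' :
  is_derive_in L c s T -> is_derive_in L eta s eta' ->
  is_derive_in L (fun u => ruled c eta u v) s (plus T (scal v eta')).
Proof.
  rewrite !is_derive_in_comps. unfold ruled. intros (A1 & B1 & C1) (A2 & B2 & C2).
  split; [|split].
  - apply (derive_in_plus _ (fun u => px (c u)) (fun u => v * px (eta u))); auto.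
    apply (derive_in_scal _ (fun u => px (eta u))); auto.
  - apply (derive_in_plus _ (fun u => py (c u)) (fun u => v * py (eta u))); auto.
    apply (derive_in_scal _ (fun u => py (eta u))); auto.
  - apply (derive_in_plus _ (fun u => pz (c u)) (fun u => v * pz (eta u))); auto.
    apply (derive_in_scal _ (fun u => pz (eta u))); auto.
Qed.

Lemma is_derive_in_const L s (e : R3) : is_derive_in L (fun _ => e) s (0, 0, 0).
Proof. apply is_derive_in_comps. split; [|split]; apply derive_in_const. Qed.

Lemma ruled_const_derive_in L c e s v T :
  is_derive_in L c s T -> is_derive_in L (fun u => ruled c (fun _ => e) u v) s T.
Proof.
  intros H. replace T with (plus T (scal v ((0, 0, 0) : R3))).
  - apply ruled_derive_in; auto. apply is_derive_in_const.
  - apply R3_eq; rewrite ?px_plus, ?py_plus, ?pz_plus, ?px_scal, ?py_scal, ?pz_scal;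
      unfold px, py, pz; cbn [fst snd]; ring.
Qed.

Lemma DeriveV_ext (f g : R -> R3) s : (forall u, f u = g u) -> DeriveV f s = DeriveV g s.
Proof.
  intros E. apply R3_eq; apply Derive_ext; intros u; now rewrite E.
Qed.

Lemma DeriveV_const (e : R3) s : DeriveV (fun _ => e) s = (0, 0, 0).
Proof. unfold DeriveV. rewrite !Derive_const. reflexivity. Qed.

Lemma DeriveV_ruled_v c eta s v : DeriveV (ruled c eta s) v = eta s.
Proof.
  pose proof (proj1 (filterdiff_R3 (locally v) _ _) (is_derive_ruled_v c eta s v)) as (H1 & H2 & H3).
  apply R3_eq; apply is_derive_unique; assumption.
Qed.

(** Constant rulings make the derivatives [psv] and [pvv] zero, hence also the numerator. The
    quotient is then 0 whatever the denominator, since division is multiplication by the inverse. *)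
Lemma gauss_curvature_cylinder c e s v : gauss_curvature (ruled c (fun _ => e)) s v = 0.
Proof.
  unfold gauss_curvature.
  rewrite (DeriveV_ext (fun u => DeriveV (ruled c (fun _ => e) u) v) (fun _ => e))
    by (intros; apply DeriveV_ruled_v).
  rewrite (DeriveV_ext (fun w => DeriveV (ruled c (fun _ => e) s) w) (fun _ => e))
    by (intros; apply DeriveV_ruled_v).
  rewrite !DeriveV_const.
  replace (dot (0, 0, 0) _) with 0 by (unfold dot, px, py, pz; cbn [fst snd]; ring).
  unfold Rdiv. ring.
Qed.

Lemma crease_first_form b L zeta l m e : fundamental_data b L zeta -> slope_bound L zeta l ->
  dot e e = 1 -> (forall s, dot (crease_velocity zeta l s) e = - Derive zeta s) ->
  forall s v, 0 <= s <= L ->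
  is_first_form L (ruled (crease_lm zeta l m) (fun _ => e)) s v 1 (- Derive zeta s) 1.
Proof.
  intros Hf Hl He HTe s v Hs. exists (crease_velocity zeta l s), e.
  split; [apply ruled_const_derive_in, (crease_lm_derive b); auto|].
  split; [apply (is_derive_ruled_v _ (fun _ => e))|].
  split; [apply (crease_velocity_unit b L); auto|]. auto.
Qed.

(* The two rulings compatible with the crease: [k = 1] gives [xi_l l] and [k = -1]
   gives [xi_check]; each makes the angle [atan (k * l / speed)] with the osculating plane. *)
Definition ruling (k l : R) : R3 :=
  scal (/ (1 + l ^ 2)) ((0, k * l ^ 2 - 1, - (1 + k) * l) : R3).

Lemma ruling_1 l : ruling 1 l = xi_l l.
Proof. unfold ruling, xi_l. do 2 f_equal; [f_equal|]; ring. Qed.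

Lemma ruling_m1 l : ruling (-1) l = xi_check.
Proof.
  assert (1 + l ^ 2 <> 0) by nra.
  apply R3_eq; unfold ruling; rewrite ?px_scal, ?py_scal, ?pz_scal;
    unfold xi_check, px, py, pz; cbn [fst snd]; field; auto.
Qed.

Lemma ruling_unit k l : k * k = 1 -> dot (ruling k l) (ruling k l) = 1.
Proof.
  intros Hk. assert (1 + l ^ 2 <> 0) by nra.
  unfold dot, ruling; rewrite ?px_scal, ?py_scal, ?pz_scal; unfold px, py, pz; cbn [fst snd].
  transitivity ((l ^ 2 * (k * k * (1 + l ^ 2)) + 1 + l ^ 2) / ((1 + l ^ 2) * (1 + l ^ 2)));
    [field; auto|].
  rewrite Hk. field; auto.
Qed.

Lemma ruling_velocity zeta k l s : dot (crease_velocity zeta l s) (ruling k l) = - Derive zeta s.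
Proof.
  assert (1 + l ^ 2 <> 0) by nra.
  unfold dot, ruling, crease_velocity; rewrite ?px_scal, ?py_scal, ?pz_scal;
    unfold px, py, pz; cbn [fst snd]. field; auto.
Qed.

(** Put [r = sqrt (1 - zeta'^2)]. The ruling has frame coordinates given by [cos beta = - zeta'],
    [sin beta = r], [cos alpha = A / (M r)] and [sin alpha = k l / (M r)]; only the last depends on
    [k], so the two rulings have opposite first angles. *)
Lemma crease_developable b L zeta l m k alpha :
  fundamental_data b L zeta -> slope_bound L zeta l -> k * k = 1 ->
  (forall s, alpha s = atan (k * l / speed zeta l s)) ->
  developable_along L (fun s => zeta s - b) zeta (crease_lm zeta l m) (fun _ => ruling k l) alpha.
Proof.
  intros Hf Hl Hk Ha. assert (HL : 0 < L) by apply Hf.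
  assert (Hslope : forall s, 0 <= s <= L -> 0 < 1 - 2 * Derive zeta s ^ 2) by apply Hf.
  set (r := fun s => sqrt (1 - Derive zeta s ^ 2)).
  assert (Hr : forall s, 0 <= s <= L -> 0 < r s /\ r s * r s = 1 - Derive zeta s ^ 2).
  { intros s Hs. specialize (Hslope s Hs). split; [apply sqrt_lt_R0|apply sqrt_sqrt]; nra. }
  assert (HCz : forall n, Ck L n (Derive zeta)) by (apply (fundamental_Ck b); auto).
  assert (HCs : forall n, Ck L n (speed zeta l)).
  { apply (speed_Ck b); auto. }
  split; [|split; [|split; [|split; [|split; [|split]]]]].
  - exists (fun _ => (0, 0, 0)). split.
    + apply continuous_continuous_on. intros. apply continuous_const.
    + intros. apply is_derive_in_const.
  - apply smooth_open_Ck. intros n.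
    apply Ck_ext with (fun s => atan (k * l * / speed zeta l s)); [intros; symmetry; apply Ha|].
    apply Ck_atan, Ck_mult; [apply Ck_const|apply Ck_inv; auto].
    intros s Hs. pose proof (speed_pos _ _ _ Hl s Hs). lra.
  - intros s Hs. rewrite Ha. pose proof (atan_bound (k * l / speed zeta l s)).
    apply Rabs_def1; lra.
  (* The shift by [PI / 2] puts [beta] in [(0, PI)] and turns the sine of the arctangent, which is
     [zeta'], into [cos beta = - zeta']. *)
  - exists (fun s => PI / 2 + atan (Derive zeta s / r s)). split; [|split].
    + apply smooth_open_Ck. intros n. apply Ck_plus; [apply Ck_const|].
      apply Ck_atan, Ck_mult; auto. apply Ck_inv.
      * intros s Hs. destruct (Hr s ltac:(lra)). lra.
      * apply Ck_sqrt.
        -- intros s Hs. specialize (Hslope s ltac:(lra)). nra.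
        -- apply Ck_ext with (fun s => 1 + -1 * (Derive zeta s * Derive zeta s));
             [intros; simpl; ring|].
           apply Ck_plus; [apply Ck_const|]. repeat apply Ck_mult; auto; apply Ck_const.
    + intros s Hs. pose proof (atan_bound (Derive zeta s / r s)). lra.
    + intros s Hs.
      destruct (crease_lm_frame b L zeta l m Hf Hl s Hs) as (-> & _ & -> & ->).
      rewrite Ha.
      pose proof (speed_pos _ _ _ Hl s Hs) as HA.
      pose proof (speed_sqr _ _ _ (Rlt_le _ _ (Hl s Hs))) as EA.
      destruct (Hr s ltac:(lra)) as [Hr0 Er].
      set (M := sqrt (1 + l ^ 2)).
      assert (HM : 0 < M) by (apply sqrt_lt_R0; nra).
      assert (EM : M * M = 1 + l ^ 2) by (apply sqrt_sqrt; nra).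
      unfold crease_velocity.
      set (A := speed zeta l s) in *. set (P := Derive zeta s) in *. set (ra := r s) in *.
      destruct (cos_sin_atan_ratio P ra 1 Hr0 Rlt_0_1 ltac:(rewrite Er; ring)) as [E1 E2].
      (* The hypotenuse is [M r] because [l^2 + A^2 = 1 + l^2 - M^2 P^2 = M^2 (1 - P^2)]. *)
      destruct (cos_sin_atan_ratio (k * l) A (M * ra)) as [E3 E4]; auto.
      { apply Rmult_lt_0_compat; auto. }
      { transitivity (M * M * (ra * ra)); [ring|]. rewrite EM, Er.
        transitivity (k * k * l ^ 2 + A * A); [|ring]. rewrite Hk, EA. ring. }
      rewrite cos_plus, sin_plus, cos_PI2, sin_PI2, E1, E2, E3, E4.
      assert (EA' : A * A = 1 - M * M * P * P) by (rewrite EA, EM; ring).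
      apply R3_eq; unfold ruling;
        rewrite ?px_plus, ?py_plus, ?pz_plus, ?px_scal, ?py_scal, ?pz_scal,
         ?px_plus, ?py_plus, ?pz_plus, ?px_scal, ?py_scal, ?pz_scal;
        unfold px, py, pz; cbn [fst snd].
      * rewrite <- EM. field; repeat split; lra.
      * rewrite <- EM.
        transitivity (- P * P - A * A / (M * M) + k * (l * l) / (M * M)).
        -- rewrite EA'. field; repeat split; lra.
        -- field; repeat split; lra.
      * rewrite <- EM.
        transitivity (- l * P * P - l * (A * A) / (M * M) - k * l / (M * M)).
        -- rewrite EA'. field; repeat split; lra.
        -- field; repeat split; lra.
  - intros s v s' v' [Hs Hv] [Hs' Hv'] E.
    (* The ruling has no x-component, so the abscissa of a point determines [s]; its inner product
       with the unit ruling then determines [v]. *)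
    assert (Hx : forall u w, px (ruled (crease_lm zeta l m) (fun _ => ruling k l) u w) =
        px (crease_lm zeta l m u)).
    { intros u w. unfold ruled, ruling. rewrite px_plus, !px_scal.
      unfold px at 2; cbn [fst snd]. ring. }
    assert (Es : s = s').
    { apply (crease_lm_px_inj b L zeta l m); auto. rewrite <- (Hx s v), E. apply Hx. }
    subst s'. split; auto.
    assert (Hu : dot (ruling k l) (ruling k l) = 1) by (apply ruling_unit; auto).
    set (e := ruling k l) in *.
    assert (Ek : forall u, dot (ruled (crease_lm zeta l m) (fun _ => e) s u) e
        = dot (crease_lm zeta l m s) e + u * dot e e).
    { intros u. unfold ruled, dot.
      rewrite ?px_plus, ?py_plus, ?pz_plus, ?px_scal, ?py_scal, ?pz_scal. ring. }
    pose proof (Ek v) as K1. rewrite E, Ek, Hu in K1. lra.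
  - intros s v [Hs Hv]. exists (crease_velocity zeta l s), (ruling k l).
    split; [apply ruled_const_derive_in, (crease_lm_derive b); auto|].
    split; [apply (is_derive_ruled_v _ (fun _ => ruling k l))|].
    (* The squared length of the cross product is [1 - zeta'^2], which is positive since
       [2 zeta'^2 < 1]. *)
    intros E. pose proof (dot_cross_cross (crease_velocity zeta l s) (ruling k l)) as K.
    rewrite E, (crease_velocity_unit b L), ruling_unit, ruling_velocity in K by auto.
    unfold dot, px, py, pz in K; cbn [fst snd] in K. specialize (Hslope s Hs). nra.
  - intros. apply gauss_curvature_cylinder.
Qed.

(** * The family is a deformation *)

(** For [c <= a], the square of [sqrt a - sqrt c] is at most its product with [sqrt a + sqrt c],
    which is [a - c]. *)
Lemma Rabs_sqrt_minus_le a c : 0 <= a -> 0 <= c -> Rabs (sqrt a - sqrt c) <= sqrt (Rabs (a - c)).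
Proof.
  assert (K : forall a c, 0 <= c -> c <= a -> Rabs (sqrt a - sqrt c) <= sqrt (Rabs (a - c))).
  { clear. intros a c Hc Hca.
    pose proof (sqrt_le_1 c a Hc ltac:(lra) Hca). pose proof (sqrt_pos c).
    rewrite !Rabs_right by lra.
    apply Rsqr_incr_0_var; [|apply sqrt_pos]. rewrite Rsqr_sqrt by lra. unfold Rsqr.
    pose proof (sqrt_sqrt a ltac:(lra)). pose proof (sqrt_sqrt c Hc). nra. }
  intros Ha Hc. destruct (Rle_dec c a); [apply K; lra|].
  rewrite Rabs_minus_sym, (Rabs_minus_sym a). apply K; lra.
Qed.

Lemma speed_le_1 zeta l w : speed zeta l w <= 1.
Proof.
  unfold speed. apply Rle_trans with (sqrt 1); [|rewrite sqrt_1; lra]. apply sqrt_le_1_alt.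
  pose proof (pow2_ge_0 (Derive zeta w)). pose proof (pow2_ge_0 l). nra.
Qed.

Lemma ex_RInt_speed b L zeta l : fundamental_data b L zeta ->
  forall s s', 0 <= s <= L -> 0 <= s' <= L -> ex_RInt (speed zeta l) s s'.
Proof.
  intros Hf s s' Hs Hs'. apply (ex_RInt_continuous (V := R_CompleteNormedModule)).
  intros z Hz. apply (continuous_speed b L); auto.
  pose proof (Rmin_glb s s' 0 ltac:(lra) ltac:(lra)).
  pose proof (Rmax_lub s s' L ltac:(lra) ltac:(lra)). lra.
Qed.

(* The integrand is 1/2-Hoelder in [l ^ 2]; this survives at the endpoints, where the speed
   may vanish and is not differentiable in [l]. *)
Lemma RInt_speed_modulus b L zeta l l0 s s0 : fundamental_data b L zeta ->
  slope_bound L zeta l -> slope_bound L zeta l0 -> 0 <= s <= L -> 0 <= s0 <= L ->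
  Rabs (RInt (speed zeta l) 0 s - RInt (speed zeta l0) 0 s0) <=
  L * sqrt (Rabs (l ^ 2 - l0 ^ 2)) + Rabs (s - s0).
Proof.
  intros Hf Hl Hl0 Hs Hs0.
  assert (Hslope : forall u, 0 <= u <= L -> 0 < 1 - 2 * Derive zeta u ^ 2) by apply Hf.
  pose proof (ex_RInt_speed b L zeta l Hf 0 s ltac:(lra) Hs) as I1.
  pose proof (ex_RInt_speed b L zeta l0 Hf 0 s ltac:(lra) Hs) as I2.
  pose proof (ex_RInt_speed b L zeta l0 Hf 0 s0 ltac:(lra) Hs0) as I3.
  pose proof (ex_RInt_speed b L zeta l0 Hf s0 s Hs0 Hs) as I4.
  pose proof (RInt_Chasles (V := R_CompleteNormedModule) _ _ _ _ I3 I4) as C.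
  change (RInt (speed zeta l0) 0 s0 + RInt (speed zeta l0) s0 s = RInt (speed zeta l0) 0 s) in C.
  (* First the parameter changes over the fixed interval [[0, s]], then the upper limit changes at
     the fixed parameter [l0], where the integrand is at most 1. *)
  replace (RInt (speed zeta l) 0 s - RInt (speed zeta l0) 0 s0) with
    ((RInt (speed zeta l) 0 s - RInt (speed zeta l0) 0 s) + RInt (speed zeta l0) s0 s) by lra.
  eapply Rle_trans; [apply Rabs_triang|]. apply Rplus_le_compat.
  - eapply Rle_trans; [|apply Rmult_le_compat_r; [apply sqrt_pos|apply (proj2 Hs)]].
    pose proof (is_RInt_minus (V := R_NormedModule) _ _ _ _ _ _
      (RInt_correct (V := R_CompleteNormedModule) _ _ _ I1)
      (RInt_correct (V := R_CompleteNormedModule) _ _ _ I2)) as K.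
    apply (norm_RInt_le_const_abs (V := R_NormedModule)) with (M := sqrt (Rabs (l ^ 2 - l0 ^ 2))) in K.
    + rewrite (Rabs_right (s - 0)), Rminus_0_r in K by lra. exact K.
    + intros x. rewrite Rmin_left, Rmax_right by lra. intros Hx.
      change (Rabs (speed zeta l x - speed zeta l0 x) <= sqrt (Rabs (l ^ 2 - l0 ^ 2))).
      pose proof (slope_bound_closed b L zeta l Hf Hl x ltac:(lra)).
      pose proof (slope_bound_closed b L zeta l0 Hf Hl0 x ltac:(lra)).
      (* The radicands differ by [(l^2 - l0^2) zeta'^2], and the factor [zeta'^2 < 1 / 2] may be
         dropped. *)
      unfold speed. eapply Rle_trans; [apply Rabs_sqrt_minus_le; lra|].
      apply sqrt_le_1_alt.
      replace (1 - (1 + l ^ 2) * Derive zeta x ^ 2 - (1 - (1 + l0 ^ 2) * Derive zeta x ^ 2))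
        with (- ((l ^ 2 - l0 ^ 2) * Derive zeta x ^ 2)) by ring.
      rewrite Rabs_Ropp, Rabs_mult, (Rabs_right (Derive zeta x ^ 2))
        by (apply Rle_ge, pow2_ge_0).
      pose proof (Hslope x ltac:(lra)). pose proof (Rabs_pos (l ^ 2 - l0 ^ 2)).
      pose proof (pow2_ge_0 (Derive zeta x)). nra.
  - pose proof (RInt_correct (V := R_CompleteNormedModule) _ _ _ I4) as K.
    apply (norm_RInt_le_const_abs (V := R_NormedModule)) with (M := 1) in K.
    + rewrite Rmult_1_r in K. exact K.
    + intros x _. change (Rabs (speed zeta l0 x) <= 1).
      rewrite Rabs_right by (apply Rle_ge, sqrt_pos). apply speed_le_1.
Qed.

Lemma map_lm_px zeta l m s v : px (map_lm zeta l m s v) = RInt (speed zeta l) 0 s + m.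
Proof.
  unfold map_lm. destruct (Rle_dec 0 v); rewrite px_plus, px_scal; unfold xi_l;
    rewrite ?px_scal; unfold px, crease_lm, xi_check; cbn [fst snd]; unfold speed; ring.
Qed.

(** Writing the case distinction with [Rmax 0 v] and [Rmin 0 v] makes continuity across the crease
    [v = 0] a matter of composition. *)
Lemma map_lm_py zeta l m s v :
  py (map_lm zeta l m s v) = zeta s + Rmax 0 v * (/ (1 + l ^ 2) * (l ^ 2 - 1)) + -1 * Rmin 0 v.
Proof.
  unfold map_lm. destruct (Rle_dec 0 v); rewrite py_plus, py_scal; unfold xi_l;
    rewrite ?py_scal; unfold py, crease_lm, xi_check; cbn [fst snd].
  - rewrite Rmax_right, Rmin_left by lra. ring.
  - rewrite Rmax_left, Rmin_right by lra. ring.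
Qed.

Lemma map_lm_pz zeta l m s v :
  pz (map_lm zeta l m s v) = l * zeta s + Rmax 0 v * (/ (1 + l ^ 2) * - (2 * l)).
Proof.
  unfold map_lm. destruct (Rle_dec 0 v); rewrite pz_plus, pz_scal; unfold xi_l;
    rewrite ?pz_scal; unfold pz, crease_lm, xi_check; cbn [fst snd].
  - rewrite Rmax_right by lra. ring.
  - rewrite Rmax_left by lra. ring.
Qed.

Lemma continuous_Rabs y : continuous Rabs y.
Proof. apply continuity_pt_filterlim, Rcontinuity_abs. Qed.

Lemma continuous_Rabs_comp (f : R -> R) x :
  continuous f x -> continuous (fun u => Rabs (f u)) x.
Proof. intros H. apply (continuous_comp f Rabs); [exact H|apply continuous_Rabs]. Qed.

Lemma continuous_Rmax0 y : continuous (Rmax 0) y.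
Proof.
  apply continuous_ext with (fun x => (x + Rabs x) * / 2).
  - intros x. unfold Rmax, Rabs. destruct (Rcase_abs x), (Rle_dec 0 x); lra.
  - apply (continuous_mult (K := R_AbsRing)); [|apply continuous_const].
    apply (continuous_plus (V := R_NormedModule)); [apply continuous_id|apply continuous_Rabs].
Qed.

Lemma continuous_Rmin0 y : continuous (Rmin 0) y.
Proof.
  apply continuous_ext with (fun x => x + -1 * Rmax 0 x).
  - intros x. unfold Rmax, Rmin. destruct (Rle_dec 0 x); lra.
  - apply (continuous_plus (V := R_NormedModule)); [apply continuous_id|].
    apply (continuous_scal_r (V := R_NormedModule)), continuous_Rmax0.
Qed.

Lemma map_lm_continuous b L zeta lambda mu : fundamental_data b L zeta ->
  admissible L zeta lambda mu ->
  continuous_on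
    (fun q : R * R * R => 0 <= fst (fst q) <= 1 /\ U b L zeta (snd (fst q)) (snd q))
    (fun q : R * R * R => map_lm zeta (lambda (fst (fst q))) (mu (fst (fst q))) (snd (fst q)) (snd q)).
Proof.
  intros Hf (Hcl & Hcm & _ & _ & _ & _ & Hsl).
  set (D := fun q : R * R * R => 0 <= fst (fst q) <= 1 /\ U b L zeta (snd (fst q)) (snd q)).
  assert (Ht : continuous_on D (fun q => fst (fst q))).
  { apply continuous_continuous_on. intros q _.
    apply (continuous_comp (fun u : R3 => fst u) fst); apply continuous_fst. }
  assert (Hs : continuous_on D (fun q => snd (fst q))).
  { apply continuous_continuous_on. intros q _.
    apply (continuous_comp (fun u : R3 => fst u) snd); [apply continuous_fst|apply continuous_snd]. }
  assert (Hv : continuous_on D (fun q => snd q)).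
  { apply continuous_continuous_on. intros q _. apply continuous_snd. }
  assert (Hl : continuous_on D (fun q => lambda (fst (fst q)))).
  { apply (continuous_on_compose _ _ _ D (fun t => 0 <= t <= 1)); auto. intros q Hq; apply Hq. }
  assert (Hm : continuous_on D (fun q => mu (fst (fst q)))).
  { apply (continuous_on_compose _ _ _ D (fun t => 0 <= t <= 1)); auto. intros q Hq; apply Hq. }
  assert (Hz : continuous_on D (fun q => zeta (snd (fst q)))).
  { apply (continuous_on_compose _ _ _ D (fun s => 0 <= s <= L)); auto; [|intros q Hq; apply Hq].
    apply continuous_continuous_on. intros s Hs0. apply (ex_derive_continuous zeta).
    eexists; apply (fundamental_derive b L); auto. }
  assert (HI : continuous_on D (fun q => RInt (speed zeta (lambda (fst (fst q)))) 0 (snd (fst q)))).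
  { intros q0 Hq0.
    (* The right-hand side of the modulus estimate is continuous in [q] and vanishes at [q0], which
       gives continuity of the integral jointly in the parameter and its upper limit. *)
    assert (Hh : continuous_on D (fun q => L * sqrt (Rabs (lambda (fst (fst q)) ^ 2 -
       lambda (fst (fst q0)) ^ 2)) + Rabs (snd (fst q) - snd (fst q0)))).
    { apply continuous_on_plus.
      - apply continuous_on_mult; [apply continuous_on_const|].
        apply (continuous_on_postcompose _ D (fun q => lambda (fst (fst q)))
          (fun l => sqrt (Rabs (l ^ 2 - lambda (fst (fst q0)) ^ 2)))); auto.
        intros y. apply continuous_sqrt_comp, continuous_Rabs_comp.
        apply (ex_derive_continuous (fun l => l ^ 2 - lambda (fst (fst q0)) ^ 2)). auto_derive; auto.
      - apply (continuous_on_postcompose _ D (fun q => snd (fst q))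
          (fun s => Rabs (s - snd (fst q0)))); auto.
        intros y. apply continuous_Rabs_comp.
        apply (ex_derive_continuous (fun l => l - snd (fst q0))). auto_derive; auto. }
    intros P [eps HP]. specialize (Hh q0 Hq0 _ (locally_ball _ eps)).
    unfold filtermap, within in *. revert Hh. apply filter_imp. intros q Hb Dq. apply HP.
    specialize (Hb Dq).
    change (Rabs (RInt (speed zeta (lambda (fst (fst q)))) 0 (snd (fst q)) -
       RInt (speed zeta (lambda (fst (fst q0)))) 0 (snd (fst q0))) < eps).
    eapply Rle_lt_trans; [apply (RInt_speed_modulus b L); auto|].
    - intros s Hs1. apply Hsl; auto. apply Dq.
    - intros s Hs1. apply Hsl; auto. apply Hq0.
    - apply Dq.
    - apply Hq0.
    - match type of Hb with ball ?x _ ?y => change (Rabs (y - x) < eps) in Hb end.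
      rewrite (Rminus_diag (lambda (fst (fst q0)) ^ 2)), (Rminus_diag (snd (fst q0))),
        Rabs_R0, sqrt_0, Rmult_0_r, Rplus_0_l, Rminus_0_r in Hb.
      apply Rabs_def2 in Hb. lra. }
  apply continuous_on_comps. split; [|split].
  - apply continuous_on_ext with (fun q => RInt (speed zeta (lambda (fst (fst q)))) 0 (snd (fst q))
       + mu (fst (fst q))).
    + intros q _. symmetry. apply map_lm_px.
    + apply continuous_on_plus; auto.
  - eapply continuous_on_ext; [intros q _; symmetry; apply map_lm_py|].
    apply continuous_on_plus; [apply continuous_on_plus|]; auto.
    + apply continuous_on_mult.
      * apply continuous_on_postcompose; auto. apply continuous_Rmax0.
      * apply (continuous_on_postcompose _ D _ (fun l => / (1 + l ^ 2) * (l ^ 2 - 1))); auto.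
        intros l. apply (ex_derive_continuous (fun l => / (1 + l ^ 2) * (l ^ 2 - 1))).
        auto_derive. nra.
    + apply continuous_on_mult; [apply continuous_on_const|].
      apply continuous_on_postcompose; auto. apply continuous_Rmin0.
  - eapply continuous_on_ext; [intros q _; symmetry; apply map_lm_pz|].
    apply continuous_on_plus; apply continuous_on_mult; auto.
    + apply continuous_on_postcompose; auto. apply continuous_Rmax0.
    + apply (continuous_on_postcompose _ D _ (fun l => / (1 + l ^ 2) * - (2 * l))); auto.
      intros l. apply (ex_derive_continuous (fun l => / (1 + l ^ 2) * - (2 * l))).
      auto_derive. nra.
Qed.

Lemma xi_l_1 : xi_l 1 = xi.
Proof. apply R3_eq; unfold xi_l; rewrite ?px_scal, ?py_scal, ?pz_scal; unfold xi, px, py, pz; cbn [fst snd]; field. Qed.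

Lemma xi_l_0 : xi_l 0 = xi_check.
Proof. apply R3_eq; unfold xi_l; rewrite ?px_scal, ?py_scal, ?pz_scal; unfold xi_check, px, py, pz; cbn [fst snd]; field. Qed.

Lemma crease_lm_1_0 zeta s : crease_lm zeta 1 0 s = pillow_crease zeta s.
Proof.
  unfold crease_lm, pillow_crease. rewrite Rplus_0_r, Rmult_1_l. apply (f_equal2 pair); auto. apply (f_equal2 pair); auto.
  apply RInt_ext. intros x _. f_equal. ring.
Qed.

Lemma crease_lm_0_0 zeta s : crease_lm zeta 0 0 s = developing_crease zeta s.
Proof.
  unfold crease_lm, developing_crease. rewrite Rplus_0_r, Rmult_0_l. apply (f_equal2 pair); auto. apply (f_equal2 pair); auto.
  apply RInt_ext. intros x _. f_equal. ring.
Qed.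

Lemma map_lm_deformation b L zeta lambda mu : fundamental_data b L zeta ->
  admissible L zeta lambda mu ->
  quarter_origami_deformation b L zeta (fun t s v => map_lm zeta (lambda t) (mu t) s v).
Proof.
  intros Hf Ha. split; [apply map_lm_continuous; auto|].
  destruct Ha as (_ & _ & Hm0 & Hm1 & Hl1 & Hl0 & Hsl).
  split; [|split].
  - intros s v _. unfold map_lm, origami_param. rewrite Hl0, Hm0, crease_lm_1_0, xi_l_1. reflexivity.
  - intros s v _. unfold map_lm, developing_map. rewrite Hl1, Hm1, crease_lm_0_0, xi_l_0.
    now destruct (Rle_dec 0 v).
  - exists (fun t => crease_lm zeta (lambda t) (mu t)), (fun t _ => xi_l (lambda t)).
    intros t Ht.
    assert (Hl : slope_bound L zeta (lambda t)) by (intros s Hs; apply Hsl; auto).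
    set (l := lambda t) in *. set (m := mu t).
    assert (Hg : glued L (fun s => zeta s - b) zeta (crease_lm zeta l m) (fun _ => xi_l l)
       (fun _ => xi_check) (fun s v => map_lm zeta l m s v)).
    { split; intros s v _ Hv; unfold map_lm, ruled; destruct (Rle_dec 0 v); try lra; auto.
      replace v with 0 by lra. apply R3_eq;
      rewrite ?px_plus, ?py_plus, ?pz_plus, ?px_scal, ?py_scal, ?pz_scal; ring. }
    assert (Hop : opposite_angles L (fun s => zeta s - b) zeta (crease_lm zeta l m)
       (fun _ => xi_l l) (fun _ => xi_check) (fun s => atan (l / speed zeta l s))).
    { pose proof (fundamental_Ck b L zeta Hf) as HC.
      split; [|split; [|split]].
      - split; [|split].
        + apply smooth_open_Ck. intros n. apply (Ck_plus L n zeta (fun _ => - b)); [apply HC|apply Ck_const].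
        + apply smooth_open_Ck. intros n. apply HC.
        + intros s Hs. pose proof (proj1 (proj2 (proj2 (proj2 (proj2 (proj2 (proj2 Hf)))))) s Hs). lra.
      - apply (crease_lm_is_crease b); auto.
      - rewrite <- (ruling_1 l). apply crease_developable; auto; [ring|].
        intros s. now rewrite Rmult_1_l.
      - rewrite <- (ruling_m1 l). apply crease_developable; auto; [ring|].
        intros s. rewrite <- atan_opp. f_equal. unfold Rdiv. ring. }
    split; [|split; [|split]].
    (* [lambda] may vanish at times other than [t = 1]; the angle [atan (l / A)] is then identically
       zero, and otherwise it vanishes nowhere inside. *)
    + destruct (Req_dec l 0) as [E|E]; [right|left]; split; auto; eexists; (split; [exact Hop|]);
        intros s Hs; cbn beta.
      * rewrite E. unfold Rdiv. rewrite Rmult_0_l. apply atan_0.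
      * apply Rabs_pos_lt. intros H0.
        pose proof (speed_pos _ _ _ Hl s Hs).
        apply E. apply (f_equal tan) in H0. rewrite tan_atan, tan_0 in H0.
        apply (Rmult_eq_reg_r (/ speed zeta l s)); [|apply Rinv_neq_0_compat; lra].
        rewrite Rmult_0_l. exact H0.
    + intros s v [Hs _] _. apply (crease_first_form b); auto.
      * rewrite <- ruling_1. apply ruling_unit. ring.
      * intros u. rewrite <- ruling_1. apply ruling_velocity.
    + intros s v [Hs _] _. apply (crease_first_form b); auto.
      * rewrite <- (ruling_m1 l). apply ruling_unit. ring.
      * intros u. rewrite <- (ruling_m1 l). apply ruling_velocity.
    + destruct Hf as (_ & _ & _ & _ & Hz0 & HzL & _).
      unfold on_x_axis, crease_lm, py, pz; cbn [fst snd]. rewrite Hz0, HzL.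
      repeat split; ring.
Qed.

(** * Rigidity of deformations *)

Lemma dot_comm u w : dot u w = dot w u.
Proof. unfold dot. ring. Qed.

Lemma dot_cross_l u w : dot u (cross u w) = 0.
Proof. unfold dot, cross, px, py, pz; cbn [fst snd]. ring. Qed.

Lemma dot_cross_r u w : dot w (cross u w) = 0.
Proof. unfold dot, cross, px, py, pz; cbn [fst snd]. ring. Qed.

Lemma dot_plus_r u v w : dot u (plus v w) = dot u v + dot u w.
Proof. unfold dot. rewrite px_plus, py_plus, pz_plus. ring. Qed.

Lemma dot_scal_r u k w : dot u (scal k w) = k * dot u w.
Proof. unfold dot. rewrite px_scal, py_scal, pz_scal. ring. Qed.

Lemma dot_xi_check u : dot u xi_check = - py u.
Proof. unfold dot, xi_check, px, py, pz; cbn [fst snd]. ring. Qed.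

Lemma zeta_range b L zeta : fundamental_data b L zeta ->
  forall s, 0 <= s <= L -> 0 <= zeta s <= b.
Proof.
  intros (Hb & _ & _ & _ & H0 & HL & H & _) s Hs.
  destruct (Req_dec s 0) as [->|]; [lra|]. destruct (Req_dec s L) as [->|]; [lra|].
  specialize (H s ltac:(lra)). lra.
Qed.

Lemma U_crease b L zeta : fundamental_data b L zeta ->
  forall s, 0 <= s <= L -> U b L zeta s 0.
Proof.
  intros Hf s Hs. pose proof (zeta_range _ _ _ Hf s Hs). split; [exact Hs|lra].
Qed.

Lemma first_form_ruled L c eta s v T eta' E F G : 0 < L -> 0 <= s <= L ->
  is_derive_in L c s T -> is_derive_in L eta s eta' ->
  is_first_form L (ruled c eta) s v E F G ->
  dot (plus T (scal v eta')) (plus T (scal v eta')) = E /\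
  dot (plus T (scal v eta')) (eta s) = F /\ dot (eta s) (eta s) = G.
Proof.
  intros HL Hs HT He (ps & pv & H1 & H2 & H).
  rewrite (is_derive_in_unique _ _ _ _ _ HL Hs H1 (ruled_derive_in L c eta s v T eta' HT He)) in H.
  rewrite (is_derive_R3_unique _ _ _ _ H2 (is_derive_ruled_v c eta s v)) in H.
  exact H.
Qed.

Lemma C1_comps_continuous L f f' : (forall s, 0 <= s <= L -> is_derive_in L f s (f' s)) ->
  continuous_on (fun s => 0 <= s <= L) (fun s => px (f s)) /\
  continuous_on (fun s => 0 <= s <= L) (fun s => py (f s)) /\
  continuous_on (fun s => 0 <= s <= L) (fun s => pz (f s)).
Proof.
  intros H. split; [|split]; intros s Hs; specialize (H s Hs);
    apply is_derive_in_comps in H; destruct H as (H1 & H2 & H3).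
  - exact (derive_in_continuous L (fun u => px (f u)) s _ H1).
  - exact (derive_in_continuous L (fun u => py (f u)) s _ H2).
  - exact (derive_in_continuous L (fun u => pz (f u)) s _ H3).
Qed.

Lemma zero_derive_constV L f f' : (forall s, 0 <= s <= L -> is_derive_in L f s (f' s)) ->
  (forall s, 0 < s < L -> f' s = (0, 0, 0)) ->
  forall s, 0 <= s <= L -> f s = f 0.
Proof.
  intros H H0. destruct (C1_comps_continuous _ _ _ H) as (C1 & C2 & C3).
  assert (K : forall s, 0 < s < L -> _)
    by (intros s Hs; exact (is_derive_comps_of_in L _ _ _ Hs (H s ltac:(lra)))).
  intros s Hs. apply R3_eq.
  - apply (zero_derive_const L (fun u => px (f u)) (fun u => px (f' u))); auto.
    + intros u Hu. apply (K u Hu).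
    + intros u Hu. rewrite H0; auto.
  - apply (zero_derive_const L (fun u => py (f u)) (fun u => py (f' u))); auto.
    + intros u Hu. apply (K u Hu).
    + intros u Hu. rewrite H0; auto.
  - apply (zero_derive_const L (fun u => pz (f u)) (fun u => pz (f' u))); auto.
    + intros u Hu. apply (K u Hu).
    + intros u Hu. rewrite H0; auto.
Qed.

Lemma dot_self_zero u : dot u u = 0 -> u = (0, 0, 0).
Proof.
  intros H. unfold dot in H.
  apply R3_eq; [change (px u = 0)|change (py u = 0)|change (pz u = 0)]; nra.
Qed.

(* Along a ruling of positive length the coefficient E = |c' + v eta'|^2 is constant, so its
   quadratic term |eta'|^2 vanishes. *)
Lemma ruling_constant b L zeta c c' eta eta' :
  fundamental_data b L zeta ->
  (forall s, 0 <= s <= L -> is_derive_in L c s (c' s)) ->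
  (forall s, 0 <= s <= L -> is_derive_in L eta s (eta' s)) ->
  (forall s v, U b L zeta s v -> 0 <= v ->
     is_first_form L (ruled c eta) s v 1 (- Derive zeta s) 1) ->
  forall s, 0 <= s <= L -> eta s = eta 0.
Proof.
  intros Hf Hc He H. assert (HL : 0 < L) by apply Hf.
  apply (zero_derive_constV L eta eta'); auto.
  intros s Hs. apply dot_self_zero.
  assert (Hz : 0 < zeta s < b) by (apply Hf; auto).
  assert (K : forall v, 0 <= v <= zeta s ->
    dot (plus (c' s) (scal v (eta' s))) (plus (c' s) (scal v (eta' s))) = 1).
  { intros v Hv. refine (proj1 (first_form_ruled L c eta s v (c' s) (eta' s) _ _ _ HL _ _ _ (H s v _ _))).
    - lra.
    - apply Hc; lra.
    - apply He; lra.
    - split; lra.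
    - lra. }
  assert (Kv : forall v, dot (plus (c' s) (scal v (eta' s))) (plus (c' s) (scal v (eta' s))) =
    dot (c' s) (c' s) + 2 * v * dot (c' s) (eta' s) + v * v * dot (eta' s) (eta' s)).
  { intros v. unfold dot.
    rewrite ?px_plus, ?py_plus, ?pz_plus, ?px_scal, ?py_scal, ?pz_scal. ring. }
  pose proof (K 0 ltac:(lra)) as K0. pose proof (K (zeta s / 2) ltac:(lra)) as K1.
  pose proof (K (zeta s) ltac:(lra)) as K2. rewrite Kv in K0, K1, K2.
  set (z := zeta s) in *. set (d := dot (eta' s) (eta' s)) in *.
  (* The second difference of the three values at [0], [z / 2] and [z] kills the constant and linear
     terms and leaves [z^2 d / 2]. *)
  assert (z * z * d = 0) by nra.
  apply Rmult_integral in H0. destruct H0; [nra|auto].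
Qed.

Lemma is_derive_Derive f s : ex_derive_n f 2 s -> is_derive (Derive f) s (Derive (Derive f) s).
Proof. intros H. apply Derive_correct. exact H. Qed.

Lemma crease_frame L c c' : is_crease L c ->
  (forall s, 0 <= s <= L -> is_derive_in L c s (c' s)) ->
  (forall s, 0 <= s <= L -> dot (c' s) (c' s) = 1) ->
  forall s, 0 < s < L ->
  Tvec c s = c' s /\ 0 < kappa c s /\
  is_derive (fun u => py (c' u)) s (kappa c s * py (Nvec c s)) /\
  is_derive (fun u => pz (c' u)) s (kappa c s * pz (Nvec c s)) /\
  dot (Nvec c s) (Nvec c s) = 1 /\ dot (Tvec c s) (Nvec c s) = 0.
Proof.
  intros (_ & (S1 & S2 & S3) & _ & _ & HK) Hd Hu s Hs.
  assert (HT : forall u, 0 < u < L -> Tvec c u = c' u).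
  { intros u Hu'. apply (DeriveV_of_in L); auto. apply Hd. lra. }
  specialize (HK s Hs).
  set (D := DeriveV (Tvec c) s).
  assert (HN : Nvec c s = scal (/ kappa c s) D) by reflexivity.
  assert (HDN : D = scal (kappa c s) (Nvec c s)).
  { rewrite HN. apply R3_eq; rewrite ?px_scal, ?py_scal, ?pz_scal; field; lra. }
  pose proof (is_derive_Derive _ s (S1 2%nat s Hs)) as D1.
  pose proof (is_derive_Derive _ s (S2 2%nat s Hs)) as D2.
  pose proof (is_derive_Derive _ s (S3 2%nat s Hs)) as D3.
  assert (E1 : is_derive (fun u => px (c' u)) s (px D)).
  { apply is_derive_ext_loc with (fun u => px (Tvec c u)); [|exact D1].
    apply (locally_open_interval L); auto. intros u Hu'. now rewrite HT. }
  assert (E2 : is_derive (fun u => py (c' u)) s (py D)).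
  { apply is_derive_ext_loc with (fun u => py (Tvec c u)); [|exact D2].
    apply (locally_open_interval L); auto. intros u Hu'. now rewrite HT. }
  assert (E3 : is_derive (fun u => pz (c' u)) s (pz D)).
  { apply is_derive_ext_loc with (fun u => pz (Tvec c u)); [|exact D3].
    apply (locally_open_interval L); auto. intros u Hu'. now rewrite HT. }
  split; [apply HT, Hs|]. split; [exact HK|].
  split; [rewrite HDN in E2; exact E2|]. split; [rewrite HDN in E3; exact E3|].
  split.
  - rewrite HN, dot_scal_r, dot_comm, dot_scal_r, dot_self_enorm.
    change (enorm D) with (kappa c s). field. lra.
  - rewrite HN, dot_scal_r, HT by auto.
    (* Orthogonality of [T] and [N] comes from differentiating [|c'|^2 = 1]. *)
    assert (K : is_derive (fun u => dot (c' u) (c' u)) s (2 * dot (c' s) D)).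
    { unfold dot.
      replace (2 * (px (c' s) * px D + py (c' s) * py D + pz (c' s) * pz D)) with
        ((px D * px (c' s) + px (c' s) * px D) + (py D * py (c' s) + py (c' s) * py D)
          + (pz D * pz (c' s) + pz (c' s) * pz D)) by ring.
      assert (M : forall f l, is_derive f s l -> is_derive (fun u => f u * f u) s (l * f s + f s * l)).
      { intros f l Hl. apply (is_derive_mult f f s l l Hl Hl Rmult_comm). }
      apply (is_derive_plus (fun u => px (c' u) * px (c' u) + py (c' u) * py (c' u))
        (fun u => pz (c' u) * pz (c' u))); [|apply (M (fun u => pz (c' u))); auto].
      apply (is_derive_plus (fun u => px (c' u) * px (c' u)) (fun u => py (c' u) * py (c' u)));
        [apply (M (fun u => px (c' u)))|apply (M (fun u => py (c' u)))]; auto. }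
    assert (K0 : is_derive (fun u => dot (c' u) (c' u)) s 0).
    { apply is_derive_ext_loc with (fun _ => 1); [|apply (is_derive_const 1)].
      apply (locally_open_interval L); auto. intros u Hu'. rewrite Hu; lra. }
    apply is_derive_unique in K. apply is_derive_unique in K0. rewrite K in K0.
    replace (dot (c' s) D) with 0 by lra. ring.
Qed.

Lemma frame_dot T N e alpha beta :
  dot T T = 1 -> dot N N = 1 -> dot T N = 0 ->
  e = plus (scal (cos beta) T)
        (scal (sin beta) (plus (scal (cos alpha) N) (scal (sin alpha) (cross T N)))) ->
  dot T e = cos beta /\ dot (cross T N) e = sin beta * sin alpha.
Proof.
  intros HT HN HTN ->. split.
  - rewrite !dot_plus_r, !dot_scal_r, !dot_plus_r, !dot_scal_r, HT, HTN, dot_cross_l. ring.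
  - rewrite !dot_plus_r, !dot_scal_r, !dot_plus_r, !dot_scal_r, dot_cross_cross, HT, HN, HTN.
    rewrite (dot_comm _ T), (dot_comm _ N), dot_cross_l, dot_cross_r. ring.
Qed.

(** The inner product with [c'] fixes the second angle, and the one with [B] shows the sign of
    [alpha], because [sin beta > 0]. These two numbers decide whether the two rulings coincide. *)
Lemma developable_frame L de ep c c' eta alpha : is_crease L c ->
  (forall s, 0 <= s <= L -> is_derive_in L c s (c' s)) ->
  (forall s, 0 <= s <= L -> dot (c' s) (c' s) = 1) ->
  developable_along L de ep c eta alpha ->
  exists beta : R -> R, forall s, 0 < s < L ->
    0 < sin (beta s) /\
    eta s = plus (scal (cos (beta s)) (c' s))
      (scal (sin (beta s)) (plus (scal (cos (alpha s)) (Nvec c s))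
                                 (scal (sin (alpha s)) (Bvec c s)))) /\
    dot (c' s) (eta s) = cos (beta s) /\ dot (Bvec c s) (eta s) = sin (beta s) * sin (alpha s).
Proof.
  intros Hc Hd Hu (_ & _ & _ & (beta & _ & Hb & He) & _). exists beta.
  intros s Hs. destruct (crease_frame L c c' Hc Hd Hu s Hs) as (HT & _ & _ & _ & HN & HTN).
  specialize (He s Hs). specialize (Hb s Hs).
  split; [apply sin_gt_0; lra|].
  assert (HT1 : dot (Tvec c s) (Tvec c s) = 1) by (rewrite HT; apply Hu; lra).
  pose proof (frame_dot _ _ _ _ _ HT1 HN HTN He) as [F1 F2].
  rewrite HT in He, F1. split; [exact He|]. split; [exact F1|exact F2].
Qed.

(** * The y- and z-coordinates of the crease *)

Lemma slope_bound_0 b L zeta : fundamental_data b L zeta -> slope_bound L zeta 0.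
Proof.
  intros (_ & _ & _ & H & _) s Hs. specialize (H s ltac:(lra)).
  pose proof (pow2_ge_0 (Derive zeta s)). nra.
Qed.

Lemma crease_py b L zeta c c' : fundamental_data b L zeta ->
  (forall s, 0 <= s <= L -> is_derive_in L c s (c' s)) ->
  (forall s, 0 <= s <= L -> py (c' s) = Derive zeta s) -> py (c 0) = 0 ->
  forall s, 0 <= s <= L -> py (c s) = zeta s.
Proof.
  intros Hf Hd Hy H0 s Hs. destruct (C1_comps_continuous _ _ _ Hd) as (_ & C2 & _).
  assert (Hz0 : zeta 0 = 0) by apply Hf.
  assert (K : forall s, 0 <= s <= L -> py (c s) + -1 * zeta s = py (c 0) + -1 * zeta 0).
  { apply (zero_derive_const L (fun s => py (c s) + -1 * zeta s)
      (fun s => py (c' s) + -1 * Derive zeta s)).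
    - apply continuous_on_plus; auto. apply continuous_on_mult; [apply continuous_on_const|].
      apply continuous_continuous_on. intros u Hu. apply (ex_derive_continuous zeta).
      eexists; apply (fundamental_derive b L); auto.
    - intros u Hu.
      apply (is_derive_plus (fun s => py (c s)) (fun s => -1 * zeta s)).
      + apply (is_derive_comps_of_in L _ _ _ Hu (Hd u ltac:(lra))).
      + apply (is_derive_scal zeta). apply (fundamental_derive b L); auto. lra.
    - intros u Hu. rewrite Hy by lra. ring. }
  specialize (K s Hs). lra.
Qed.

(* When alpha = 0 the normal N lies in the plane of T and xi_check, so the projection of the
   crease to the (x, z)-plane is a straight segment; it joins two points of the x-axis. *)
Lemma unfolded_crease_pz b L zeta c c' : fundamental_data b L zeta -> is_crease L c ->
  (forall s, 0 <= s <= L -> is_derive_in L c s (c' s)) ->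
  (forall s, 0 <= s <= L -> dot (c' s) (c' s) = 1) ->
  continuous_on (fun s => 0 <= s <= L) c' ->
  (forall s, 0 <= s <= L -> py (c' s) = Derive zeta s) ->
  (forall s, 0 < s < L -> exists beta, 0 < sin beta /\
     xi_check = plus (scal (cos beta) (c' s)) (scal (sin beta) (Nvec c s))) ->
  pz (c 0) = 0 -> pz (c L) = 0 ->
  forall s, 0 <= s <= L -> pz (c s) = 0.
Proof.
  intros Hf Hc Hd Hu Hc' Hy Hfr H0 HL0. assert (HL : 0 < L) by apply Hf.
  destruct (C1_comps_continuous _ _ _ Hd) as (_ & _ & C3).
  apply continuous_on_comps in Hc'. destruct Hc' as (_ & _ & CT3).
  pose proof (slope_bound_0 _ _ _ Hf) as Hl0.
  assert (Hslope : forall s, 0 <= s <= L -> 0 < 1 - 2 * Derive zeta s ^ 2) by apply Hf.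
  set (r := speed zeta 0).
  assert (Hr : forall s, 0 <= s <= L -> 0 < r s /\ r s * r s = 1 - Derive zeta s ^ 2).
  { intros s Hs. specialize (Hslope s Hs). pose proof (pow2_ge_0 (Derive zeta s)).
    split; [apply sqrt_lt_R0; simpl in *; nra|].
    unfold r. rewrite speed_sqr; [ring|]. simpl in *; nra. }
  assert (Hdz : forall s, 0 < s < L -> is_derive (fun u => pz (c u)) s (pz (c' s))).
  { intros s Hs. apply (is_derive_comps_of_in L _ _ _ Hs (Hd s ltac:(lra))). }
  (* Here [r] is the length of the projection of the tangent to the (x, z)-plane, so the quotient is
     a coordinate of its direction. The expansion of [xi_check] in [T] and [N] gives
     [N_y = - sin beta] and [N_z = zeta' z' / sin beta]; with [kappa N_y = zeta''] the derivative is
     a multiple of [r^2 - sin^2 beta = 0]. *)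
  assert (Hconst : forall s, 0 <= s <= L -> pz (c' s) / r s = pz (c' 0) / r 0).
  { apply (zero_derive_const L (fun s => pz (c' s) / r s)
      (fun s => (kappa c s * pz (Nvec c s) * r s - pz (c' s) *
          (- ((1 + 0 ^ 2) * Derive zeta s * Derive_n zeta 2 s) / r s)) / r s ^ 2)).
    - apply continuous_on_mult; auto.
      apply continuous_continuous_on. intros s Hs.
      destruct (Hr s Hs). apply (continuous_comp r Rinv).
      + apply (continuous_speed b L); auto.
      + apply (ex_derive_continuous Rinv). auto_derive. lra.
    - intros s Hs. destruct (Hr s ltac:(lra)).
      apply (is_derive_div (fun u => pz (c' u)) r); [| |lra].
      + apply (crease_frame L c c'); auto.
      + apply (speed_derive b L); auto.
    - intros s Hs. destruct (Hr s ltac:(lra)) as [Hr0 Er].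
      destruct (crease_frame L c c' Hc Hd Hu s Hs) as (HT & HK & D2 & _ & HN & HTN).
      assert (E2 : kappa c s * py (Nvec c s) = Derive_n zeta 2 s).
      { transitivity (Derive (fun u => py (c' u)) s); [symmetry; apply is_derive_unique, D2|].
        apply is_derive_unique. apply is_derive_ext_loc with (Derive zeta).
        - apply (locally_open_interval L); auto. intros u Hu'. symmetry. apply Hy. lra.
        - apply (fundamental_derive2 b L); auto. lra. }
      destruct (Hfr s Hs) as (beta & Hb & E).
      assert (Ec : cos beta = - Derive zeta s).
      { assert (K : dot (c' s) xi_check = cos beta).
        { rewrite E, dot_plus_r, !dot_scal_r, Hu by lra. rewrite <- HT, HTN. ring. }
        rewrite dot_xi_check, Hy in K by lra. lra. }
      assert (Es : sin beta * sin beta = r s * r s).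
      { pose proof (sin2_cos2 beta) as K. unfold Rsqr in K. rewrite Ec in K. rewrite Er. lra. }
      pose proof (f_equal py E) as Ey. pose proof (f_equal pz E) as Ez.
      rewrite py_plus, !py_scal in Ey. rewrite pz_plus, !pz_scal in Ez.
      change (py xi_check) with (-1) in Ey. change (pz xi_check) with 0 in Ez.
      rewrite Ec in Ey, Ez. rewrite Hy in Ey by lra.
      rewrite <- E2.
      set (P := Derive zeta s) in *. set (k := kappa c s) in *. set (Z := pz (c' s)) in *.
      set (sb := sin beta) in *. set (ny := py (Nvec c s)) in *. set (nz := pz (Nvec c s)) in *.
      assert (Eny : ny = - sb).
      { apply (Rmult_eq_reg_l sb); [|lra]. simpl in Er. lra. }
      assert (Enz : nz = P * Z / sb).
      { apply (Rmult_eq_reg_l sb); [|lra]. transitivity (P * Z); [lra|field; lra]. }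
      rewrite Eny, Enz.
      transitivity (k * P * Z * (r s * r s - sb * sb) / (sb * r s * (r s * r s))).
      + field. split; lra.
      + rewrite Es. field. split; lra. }
  (* The height vanishes at both ends, so [z'] has an interior zero, and constancy of the ratio
     spreads it over the interval. *)
  destruct (MVT_in L (fun u => pz (c u)) (fun u => pz (c' u)) C3 Hdz 0 L) as [s0 [Hs0 E]]; try lra.
  rewrite H0, HL0 in E.
  assert (Z0 : pz (c' s0) = 0) by nra.
  assert (Hz : forall s, 0 < s < L -> pz (c' s) = 0).
  { intros s Hs. pose proof (Hconst s ltac:(lra)) as K1. pose proof (Hconst s0 ltac:(lra)) as K2.
    rewrite <- K2, Z0 in K1. destruct (Hr s ltac:(lra)).
    replace (pz (c' s)) with (pz (c' s) / r s * r s) by (field; lra). rewrite K1.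
    unfold Rdiv. ring. }
  intros s Hs.
  rewrite <- H0. exact (zero_derive_const L (fun u => pz (c u)) (fun u => pz (c' u)) C3 Hdz Hz s Hs).
Qed.

(* The constant vector a - xi_check is orthogonal to the tangent, so the crease is planar; the
   plane contains the direction of the x-axis. *)
Lemma folded_crease_pz b L zeta c c' a : fundamental_data b L zeta ->
  (forall s, 0 <= s <= L -> is_derive_in L c s (c' s)) ->
  (forall s s', 0 <= s <= L -> 0 <= s' <= L -> c s = c s' -> s = s') ->
  (forall s, 0 <= s <= L -> py (c s) = zeta s) ->
  (forall s, 0 < s < L -> dot (c' s) a = dot (c' s) xi_check) ->
  dot a a = 1 -> a <> xi_check -> on_x_axis (c 0) -> on_x_axis (c L) ->
  exists l, a = xi_l l /\ forall s, 0 <= s <= L -> pz (c s) = l * zeta s.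
Proof.
  intros Hf Hd Hinj Hy Hdot Ha Hne [Y0 Z0] [YL ZL]. assert (HL : 0 < L) by apply Hf.
  destruct (C1_comps_continuous _ _ _ Hd) as (C1 & C2 & C3).
  assert (K : forall s, 0 <= s <= L ->
     px (c s) * px a + (py (c s) * (py a + 1) + pz (c s) * pz a) =
     px (c 0) * px a + (py (c 0) * (py a + 1) + pz (c 0) * pz a)).
  { apply (zero_derive_const L (fun s => px (c s) * px a + (py (c s) * (py a + 1) + pz (c s) * pz a))
      (fun s => px (c' s) * px a + (py (c' s) * (py a + 1) + pz (c' s) * pz a))).
    - repeat apply continuous_on_plus; apply continuous_on_mult; auto; apply continuous_on_const.
    - intros s Hs. destruct (is_derive_comps_of_in L _ _ _ Hs (Hd s ltac:(lra))) as (D1 & D2 & D3).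
      assert (M : forall f l k, is_derive f s l -> is_derive (fun u => f u * k) s (l * k)).
      { intros f l k Hl. apply (is_derive_scal_l f s l k Hl). }
      apply (is_derive_plus (fun u => px (c u) * px a)
        (fun u => py (c u) * (py a + 1) + pz (c u) * pz a)); [apply (M (fun u => px (c u))); auto|].
      apply (is_derive_plus (fun u => py (c u) * (py a + 1)) (fun u => pz (c u) * pz a));
        [apply (M (fun u => py (c u)))|apply (M (fun u => pz (c u)))]; auto.
    - intros s Hs. specialize (Hdot s Hs). rewrite dot_xi_check in Hdot. unfold dot in Hdot. lra. }
  (* Both ends lie on the x-axis and the crease is injective, so they differ in abscissa; the plane
     equation at the two ends then forces [px a = 0]. *)
  assert (Hx : px (c L) <> px (c 0)).
  { intros E. assert (L = 0); [|lra]. apply Hinj; try lra. apply R3_eq; congruence. }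
  pose proof (K L ltac:(lra)) as KL. rewrite Y0, Z0, YL, ZL in KL.
  assert (a1 : px a = 0).
  { apply (Rmult_eq_reg_l (px (c L) - px (c 0))); lra. }
  assert (Hh : 0 < zeta (L / 2) < b) by (apply Hf; lra).
  pose proof (K (L / 2) ltac:(lra)) as K2.
  rewrite a1, Y0, Z0, Hy in K2 by lra.
  unfold dot in Ha. rewrite a1 in Ha.
  assert (a2 : py a <> -1).
  { intros E. apply Hne. apply R3_eq; [exact a1|exact E|]. change (pz a = 0). rewrite E in Ha. nra. }
  (* With [pz a = 0] the unit vector would be [(0, 1, 0)], and the plane equation would give
     [zeta (L / 2) = 0]. *)
  assert (a3 : pz a <> 0).
  { intros E. rewrite E in Ha, K2. assert (py a = 1) by nra. nra. }
  (* The slope of the plane [(py a + 1) y + pz a z = 0]. As [a] is a unit vector,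
     [1 + l^2 = 2 (py a + 1) / pz a^2], from which [a = xi_l l] follows. *)
  exists (- (py a + 1) / pz a).
  assert (E : 1 + (- (py a + 1) / pz a) ^ 2 = 2 * (py a + 1) / (pz a * pz a)).
  { transitivity ((pz a * pz a + (py a * py a) + 2 * py a + 1) / (pz a * pz a)).
    - field; auto.
    - f_equal. lra. }
  split.
  - assert (a2' : py a + 1 <> 0) by lra.
    assert (Eq : pz a * pz a = 1 - py a * py a) by lra.
    unfold xi_l. rewrite E.
    replace ((- (py a + 1) / pz a) ^ 2 - 1) with (2 * (py a + 1) / (pz a * pz a) - 2)
      by (rewrite <- E; ring).
    set (l := - (py a + 1) / pz a). set (e := 2 * (py a + 1) / (pz a * pz a)).
    apply R3_eq;
      [change (px a = / e * 0)|change (py a = / e * (e - 2))|change (pz a = / e * - (2 * l))].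
    + rewrite a1. ring.
    + unfold e. transitivity (1 - pz a * pz a / (py a + 1)); [rewrite Eq; field; auto|field; auto].
    + unfold e, l. field; auto.
  - intros s Hs. pose proof (K s Hs) as Ks. rewrite a1, Y0, Z0, Hy in Ks by lra.
    apply (Rmult_eq_reg_r (pz a)); auto.
    transitivity (- (py a + 1) * zeta s); [lra|field; auto].
Qed.

(** [zeta'] is strictly decreasing, so [zeta'^2] has no interior maximum: at a point of equality it
    grows to the left if [zeta' >= 0] and to the right if [zeta' < 0], which violates the weak bound
    there. *)
Lemma slope_bound_of_le b L zeta l : fundamental_data b L zeta ->
  (forall s, 0 < s < L -> (1 + l ^ 2) * Derive zeta s ^ 2 <= 1) -> slope_bound L zeta l.
Proof.
  intros Hf H s Hs. destruct (H s Hs) as [|E]; [auto|exfalso].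
  assert (Hdec : forall u w, 0 < u -> u < w -> w < L -> Derive zeta w < Derive zeta u).
  { intros u w H1 H2 H3.
    destruct (MVT_in L (Derive zeta) (Derive_n zeta 2)) with u w as [x [Hx Ex]]; try lra.
    - apply continuous_continuous_on, (fundamental_continuous b L), Hf.
    - intros v Hv. apply (fundamental_derive2 b L); auto; lra.
    - assert (Derive_n zeta 2 x < 0) by (apply Hf; lra). nra. }
  pose proof (Hdec (s / 2) s ltac:(lra) ltac:(lra) ltac:(lra)) as H1.
  pose proof (Hdec s ((s + L) / 2) ltac:(lra) ltac:(lra) ltac:(lra)) as H2.
  pose proof (H (s / 2) ltac:(lra)) as K1. pose proof (H ((s + L) / 2) ltac:(lra)) as K2.
  pose proof (pow2_ge_0 l) as Hl. set (m := 1 + l ^ 2) in *.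
  set (p := Derive zeta s) in *. set (p1 := Derive zeta (s / 2)) in *.
  set (p2 := Derive zeta ((s + L) / 2)) in *.
  assert (Hm : 0 < m) by (unfold m; lra).
  destruct (Rle_dec 0 p).
  - assert (p ^ 2 < p1 ^ 2) by nra. nra.
  - assert (p ^ 2 < p2 ^ 2) by nra. nra.
Qed.

(** * The abscissa and the rigidity of a single crease *)

Lemma abscissa_RInt b L zeta l f g : fundamental_data b L zeta -> slope_bound L zeta l ->
  continuous_on (fun s => 0 <= s <= L) f ->
  (forall s, 0 < s < L -> is_derive f s (g s)) ->
  (forall s, 0 < s < L -> g s = speed zeta l s) ->
  forall s, 0 <= s <= L -> f s = f 0 + RInt (speed zeta l) 0 s.
Proof.
  intros Hf Hl Cf Df Hg s Hs.
  assert (HI : forall u, 0 <= u <= L ->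
    derive_in L (fun s => RInt (speed zeta l) 0 s) u (speed zeta l u)).
  { intros u Hu. apply derive_in_RInt; auto. apply (continuous_speed b); auto. }
  assert (K : f s + -1 * RInt (speed zeta l) 0 s = f 0 + -1 * RInt (speed zeta l) 0 0).
  { apply (zero_derive_const L (fun s => f s + -1 * RInt (speed zeta l) 0 s)
      (fun s => g s + -1 * speed zeta l s)); auto.
    - apply continuous_on_plus; auto. apply continuous_on_mult; [apply continuous_on_const|].
      intros u Hu.
      exact (derive_in_continuous L (fun s => RInt (speed zeta l) 0 s) u _ (HI u Hu)).
    - intros u Hu. apply (is_derive_plus f); auto.
      apply (is_derive_scal (fun s => RInt (speed zeta l) 0 s)).
      apply (derive_in_is_derive L); auto. apply HI. lra.
    - intros u Hu. rewrite Hg by auto. ring. }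
  rewrite RInt_point in K. change zero with 0 in K. lra.
Qed.

(** The strict bound keeps [g] away from zero inside, so its sign is that at the midpoint and [g] is
    the speed up to this sign. The negative case is the positive one for [- f]. *)
Lemma abscissa_RInt_sign b L zeta l f g : fundamental_data b L zeta -> slope_bound L zeta l ->
  continuous_on (fun s => 0 <= s <= L) f ->
  continuous_on (fun s => 0 <= s <= L) g ->
  (forall s, 0 < s < L -> is_derive f s (g s)) ->
  (forall s, 0 < s < L -> g s * g s = 1 - (1 + l ^ 2) * Derive zeta s ^ 2) ->
  (forall s, 0 <= s <= L -> f s = f 0 + RInt (speed zeta l) 0 s) \/
  (forall s, 0 <= s <= L -> f s = f 0 - RInt (speed zeta l) 0 s).
Proof.
  intros Hf Hl Cf Cg Df Hg. assert (HL : 0 < L) by apply Hf.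
  assert (Hn : forall s, 0 < s < L -> g s <> 0).
  { intros s Hs E. specialize (Hg s Hs). specialize (Hl s Hs). rewrite E in Hg. lra. }
  assert (Hin : forall q s, 0 < q < L -> Rmin (L / 2) q <= s <= Rmax (L / 2) q -> 0 < s < L).
  { intros q s Hq. unfold Rmin, Rmax. destruct (Rle_dec (L / 2) q); lra. }
  assert (Hsp : forall s, 0 < s < L -> sqrt (g s * g s) = speed zeta l s).
  { intros s Hs. rewrite Hg; auto. }
  destruct (Rlt_dec 0 (g (L / 2))) as [Hp|Hp]; [left|right].
  - apply (abscissa_RInt b L zeta l f g); auto.
    intros s Hs. rewrite <- Hsp by auto. symmetry. apply sqrt_square. apply Rlt_le.
    apply (sign_constant 0 L g ltac:(lra) Cg (L / 2)); try lra.
    intros x Hx. apply Hn, (Hin s); auto.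
  - assert (Hp' : 0 < -1 * g (L / 2)) by (pose proof (Hn (L / 2) ltac:(lra)); lra).
    assert (Cg' : continuous_on (fun s => 0 <= s <= L) (fun s => -1 * g s)).
    { apply continuous_on_mult; auto. apply continuous_on_const. }
    assert (K : forall s, 0 <= s <= L -> -1 * f s = -1 * f 0 + RInt (speed zeta l) 0 s).
    { apply (abscissa_RInt b L zeta l (fun s => -1 * f s) (fun s => -1 * g s)); auto.
      - apply continuous_on_mult; auto. apply continuous_on_const.
      - intros s Hs. apply (is_derive_scal f); auto.
      - intros s Hs. rewrite <- Hsp by auto.
        replace (g s * g s) with (-1 * g s * (-1 * g s)) by ring.
        symmetry. apply sqrt_square. apply Rlt_le.
        apply (sign_constant 0 L (fun s => -1 * g s) ltac:(lra) Cg' (L / 2)); try lra.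
        intros x Hx. pose proof (Hn x (Hin s x Hs Hx)). lra. }
    intros s Hs. specialize (K s Hs). lra.
Qed.

Lemma crease_rigidity b L zeta c eta X : fundamental_data b L zeta ->
  origami_map L (fun s => zeta s - b) zeta c eta (fun _ => xi_check) X \/
  unfolded_map L (fun s => zeta s - b) zeta c eta (fun _ => xi_check) X ->
  (forall s v, U b L zeta s v -> 0 <= v ->
     is_first_form L (ruled c eta) s v 1 (- Derive zeta s) 1) ->
  (forall s v, U b L zeta s v -> v <= 0 ->
     is_first_form L (ruled c (fun _ => xi_check)) s v 1 (- Derive zeta s) 1) ->
  on_x_axis (c 0) -> on_x_axis (c L) ->
  exists l, slope_bound L zeta l /\
    (forall s, 0 <= s <= L -> eta s = xi_l l) /\
    (forall s, 0 <= s <= L -> py (c s) = zeta s) /\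
    (forall s, 0 <= s <= L -> pz (c s) = l * zeta s) /\
    ((forall s, 0 <= s <= L -> px (c s) = px (c 0) + RInt (speed zeta l) 0 s) \/
     (forall s, 0 <= s <= L -> px (c s) = px (c 0) - RInt (speed zeta l) 0 s)).
Proof.
  intros Hf HX Hp Hq H0 H1. assert (HL : 0 < L) by apply Hf.
  assert (Hop : exists alpha, opposite_angles L (fun s => zeta s - b) zeta c eta
     (fun _ => xi_check) alpha) by (destruct HX as [(_ & al & Ho & _)|(_ & al & Ho & _)]; eauto).
  destruct Hop as (al0 & _ & Hc & ((eta' & _ & Heta) & _) & _).
  pose proof Hc as ((c' & Cc' & Hd) & _ & _ & Hinj & _).
  pose proof (C1_comps_continuous _ _ _ Hd) as (C1 & C2 & C3).
  pose proof (ruling_constant b L zeta c c' eta eta' Hf Hd Heta Hp) as Hconst.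
  assert (Hq0 : forall s, 0 <= s <= L -> dot (c' s) (c' s) = 1 /\ py (c' s) = Derive zeta s).
  { intros s Hs.
    pose proof (first_form_ruled L c (fun _ => xi_check) s 0 (c' s) (0, 0, 0) _ _ _ HL Hs (Hd s Hs)
      (is_derive_in_const L s xi_check)
      (Hq s 0 (U_crease b L zeta Hf s Hs) (Rle_refl 0))) as (K1 & K2 & _).
    replace (plus (c' s) (scal 0 ((0, 0, 0) : R3))) with (c' s) in K1, K2.
    - rewrite dot_xi_check in K2. split; lra.
    - apply R3_eq; rewrite ?px_plus, ?py_plus, ?pz_plus, ?px_scal, ?py_scal, ?pz_scal; ring. }
  assert (Hu : forall s, 0 <= s <= L -> dot (c' s) (c' s) = 1) by (intros; apply Hq0; auto).
  assert (Hy' : forall s, 0 <= s <= L -> py (c' s) = Derive zeta s) by (intros; apply Hq0; auto).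
  pose proof (crease_py b L zeta c c' Hf Hd Hy' (proj1 H0)) as Hy.
  set (a := eta 0) in *.
  assert (Ha : dot a a = 1 /\ forall s, 0 < s < L -> dot (c' s) a = dot (c' s) xi_check).
  { assert (K : forall s, 0 <= s <= L -> dot (c' s) a = - Derive zeta s /\ dot a a = 1).
    { intros s Hs.
      pose proof (first_form_ruled L c eta s 0 (c' s) (eta' s) _ _ _ HL Hs (Hd s Hs)
        (Heta s Hs) (Hp s 0 (U_crease b L zeta Hf s Hs) (Rle_refl 0))) as (_ & K2 & K3).
      rewrite Hconst in K2, K3 by auto.
      replace (plus (c' s) (scal 0 (eta' s))) with (c' s) in K2; auto.
      apply R3_eq; rewrite ?px_plus, ?py_plus, ?pz_plus, ?px_scal, ?py_scal, ?pz_scal; ring. }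
    split; [apply (K 0); lra|]. intros s Hs. rewrite dot_xi_check, Hy' by lra. apply K. lra. }
  destruct Ha as [Haa Hat].
  assert (Hl : exists l, a = xi_l l /\ forall s, 0 <= s <= L -> pz (c s) = l * zeta s).
  { destruct HX as [(_ & al & (_ & _ & De & Dx) & Hal)|(_ & al & (_ & _ & De & Dx) & Hal)];
      destruct (developable_frame _ _ _ c c' _ _ Hc Hd Hu De) as (b1 & F1);
      destruct (developable_frame _ _ _ c c' _ _ Hc Hd Hu Dx) as (b2 & F2).
    - apply (folded_crease_pz b L zeta c c' a); auto.
      (* If the rulings coincided, their inner products with [B] would give
         [sin b1 sin alpha = - sin b2 sin alpha] with both [sin b1] and [sin b2] positive, hence
         [sin alpha = 0], against [0 < |alpha| < PI / 2]. *)
      intros E. assert (Hs : 0 < L / 2 < L) by lra.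
      destruct (F1 _ Hs) as (S1 & _ & _ & B1). destruct (F2 _ Hs) as (S2 & _ & _ & B2).
      rewrite Hconst, E in B1 by lra. rewrite B1, sin_neg in B2.
      pose proof De as (_ & _ & Hpi & _). specialize (Hpi _ Hs). specialize (Hal _ Hs).
      assert (Hsin : sin (al (L / 2)) = 0) by nra.
      apply Rabs_def2 in Hpi. pose proof PI_RGT_0.
      destruct (Rtotal_order (al (L / 2)) 0) as [N|[N|N]].
      + pose proof (sin_gt_0 (- al (L / 2)) ltac:(lra) ltac:(lra)) as K. rewrite sin_neg in K. lra.
      + rewrite N, Rabs_R0 in Hal. lra.
      + pose proof (sin_gt_0 (al (L / 2)) ltac:(lra) ltac:(lra)). lra.
    (* With [alpha = 0] both rulings lie in the plane of [T] and [N]; they have the same cosine with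
       [T] and positive sines, so they are equal. *)
    - assert (Hfr : forall s, 0 < s < L -> a = xi_check /\ exists beta, 0 < sin beta /\
         xi_check = plus (scal (cos beta) (c' s)) (scal (sin beta) (Nvec c s))).
      { intros s Hs. destruct (F1 s Hs) as (S1 & E1 & T1 & _).
        destruct (F2 s Hs) as (S2 & E2 & T2 & _).
        rewrite Hal in E1, E2 by auto. rewrite Hconst in E1, T1 by lra.
        rewrite Ropp_0 in E2. rewrite cos_0, sin_0 in E1, E2.
        rewrite Hat, T2 in T1 by auto.
        assert (Es : sin (b1 s) = sin (b2 s)).
        { pose proof (sin2_cos2 (b1 s)) as K1. pose proof (sin2_cos2 (b2 s)) as K2.
          unfold Rsqr in K1, K2. rewrite T1 in K2. nra. }
        assert (EN : forall N B : R3, plus (scal 1 N) (scal 0 B) = N).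
        { intros N B. apply R3_eq;
            rewrite ?px_plus, ?py_plus, ?pz_plus, ?px_scal, ?py_scal, ?pz_scal; ring. }
        rewrite EN in E1, E2. split.
        - rewrite E1, <- T1, Es. symmetry. exact E2.
        - exists (b2 s). auto. }
      exists 0. rewrite xi_l_0. split; [apply (Hfr (L / 2)); lra|].
      intros s Hs. rewrite Rmult_0_l.
      apply (unfolded_crease_pz b L zeta c c'); auto; try (apply H0); try (apply H1).
      intros u Hu'. apply Hfr, Hu'. }
  destruct Hl as (l & Ea & Hz).
  assert (Hg : forall s, 0 < s < L -> px (c' s) * px (c' s) = 1 - (1 + l ^ 2) * Derive zeta s ^ 2).
  { intros s Hs. pose proof (Hu s ltac:(lra)) as K. unfold dot in K. rewrite Hy' in K by lra.
    assert (E : pz (c' s) = l * Derive zeta s).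
    { destruct (is_derive_comps_of_in L _ _ _ Hs (Hd s ltac:(lra))) as (_ & _ & D3).
      apply is_derive_unique in D3. rewrite <- D3. apply is_derive_unique.
      apply is_derive_ext_loc with (fun u => l * zeta u).
      - apply (locally_open_interval L); auto. intros u Hu'. symmetry. apply Hz. lra.
      - apply (is_derive_scal zeta). apply (fundamental_derive b L); auto. lra. }
    rewrite E in K. lra. }
  assert (Hsl : slope_bound L zeta l).
  (* The square [x'^2 >= 0] gives the weak bound, which concavity makes strict. *)
  { apply (slope_bound_of_le b); auto. intros s Hs. specialize (Hg s Hs). nra. }
  exists l. split; [exact Hsl|]. split; [intros s Hs; rewrite <- Ea; auto|].
  split; [exact Hy|]. split; [exact Hz|].
  apply (abscissa_RInt_sign b L zeta l (fun s => px (c s)) (fun s => px (c' s))); auto.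
  - apply continuous_on_px, Cc'.
  - intros s Hs. apply (is_derive_comps_of_in L _ _ _ Hs (Hd s ltac:(lra))).
Qed.

(** * From single creases to the whole deformation *)

Lemma RInt_speed_pos b L zeta l : fundamental_data b L zeta -> slope_bound L zeta l ->
  0 < RInt (speed zeta l) 0 L.
Proof.
  intros Hf Hl. apply RInt_gt_0.
  - apply Hf.
  - intros x Hx. apply (speed_pos L); auto.
  - intros x Hx. apply (continuous_speed b L); auto.
Qed.

Lemma slope_bound_1 b L zeta : fundamental_data b L zeta -> slope_bound L zeta 1.
Proof. intros (_ & _ & _ & H & _) s Hs. specialize (H s ltac:(lra)). lra. Qed.

Lemma origami_param_crease zeta s : origami_param zeta s 0 = pillow_crease zeta s.
Proof.
  unfold origami_param. destruct (Rle_dec 0 0); [|lra].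
  apply R3_eq; rewrite ?px_plus, ?py_plus, ?pz_plus, ?px_scal, ?py_scal, ?pz_scal; ring.
Qed.

Lemma developing_map_crease zeta s : developing_map zeta s 0 = developing_crease zeta s.
Proof.
  unfold developing_map.
  apply R3_eq; rewrite ?px_plus, ?py_plus, ?pz_plus, ?px_scal, ?py_scal, ?pz_scal; ring.
Qed.

Lemma deformation_is_map_lm b L zeta X : fundamental_data b L zeta ->
  quarter_origami_deformation b L zeta X ->
  exists lambda mu : R -> R,
    admissible L zeta lambda mu /\
    forall t s v, 0 <= t <= 1 -> U b L zeta s v -> X t s v = map_lm zeta (lambda t) (mu t) s v.
Proof.
  intros Hf (HC & HX0 & HX1 & c & xit & H). assert (HL : 0 < L) by apply Hf.
  assert (Hh : 0 < zeta (L / 2) < b) by (apply Hf; lra).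
  (* Both parameters are values of [X] at fixed points of [U], so they inherit continuity in [t]
     from [X]. *)
  set (lam := fun t => pz (X t (L / 2) 0) * / zeta (L / 2)).
  set (mu := fun t => px (X t 0 0)).
  pose proof (U_crease b L zeta Hf) as HU.
  assert (Hpath : forall s, 0 <= s <= L -> continuous_on (fun t => 0 <= t <= 1) (fun t => X t s 0)).
  { intros s Hs.
    apply (continuous_on_compose _ _ _ (fun t => 0 <= t <= 1) _ (fun t => ((t, s), 0) : R3)
      (fun q : R3 => X (fst (fst q)) (snd (fst q)) (snd q))) with (2 := HC).
    - apply continuous_on_comps. split; [|split; [exact (continuous_on_const _ _ s)|
        exact (continuous_on_const _ _ 0)]].
      apply continuous_continuous_on. intros t _. apply continuous_id.
    - intros t Ht. exact (conj Ht (HU s Hs)). }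
  assert (Hcrease : forall t s, 0 <= t <= 1 -> 0 <= s <= L -> X t s 0 = c t s).
  { intros t s Ht Hs. destruct (H t Ht) as (Ho & _).
    assert (Hg : glued L (fun s => zeta s - b) zeta (c t) (xit t) (fun _ => xi_check) (X t))
      by (destruct Ho as [(Hg & _)|(Hg & _)]; exact Hg).
    rewrite (proj1 Hg s 0 (HU s Hs) (Rle_refl 0)). unfold ruled.
    apply R3_eq; rewrite ?px_plus, ?py_plus, ?pz_plus, ?px_scal, ?py_scal, ?pz_scal; ring. }
  assert (Hrig : forall t, 0 <= t <= 1 ->
    slope_bound L zeta (lam t) /\
    (forall s, 0 <= s <= L -> xit t s = xi_l (lam t)) /\
    (forall s, 0 <= s <= L -> py (c t s) = zeta s) /\
    (forall s, 0 <= s <= L -> pz (c t s) = lam t * zeta s) /\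
    ((forall s, 0 <= s <= L -> px (c t s) = mu t + RInt (speed zeta (lam t)) 0 s) \/
     (forall s, 0 <= s <= L -> px (c t s) = mu t - RInt (speed zeta (lam t)) 0 s))).
  { intros t Ht. destruct (H t Ht) as (Ho & Hp & Hq & Ha0 & HaL).
    destruct (crease_rigidity b L zeta (c t) (xit t) (X t) Hf Ho Hp Hq Ha0 HaL)
      as (l & K1 & K2 & K3 & K4 & K5).
    assert (E : lam t = l).
    { unfold lam. rewrite Hcrease, K4 by lra. field. lra. }
    unfold mu. rewrite E, Hcrease by lra. auto. }
  assert (Hgap : forall t, 0 <= t <= 1 -> 0 < px (X t L 0) + -1 * px (X t 0 0)).
  { intros t Ht.
    assert (Cg : continuous_on (fun t => 0 <= t <= 1) (fun t => px (X t L 0) + -1 * px (X t 0 0))).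
    { apply continuous_on_plus; [|apply continuous_on_mult; [apply continuous_on_const|]].
      - apply (continuous_on_px _ _ (fun t => X t L 0)), Hpath. lra.
      - apply (continuous_on_px _ _ (fun t => X t 0 0)), Hpath. lra. }
    (* For every [t] the difference is plus or minus the integral of a positive speed, hence
       nonzero; at [t = 0] it is the integral for the pillow crease, with the plus sign. *)
    apply (sign_constant 0 1 (fun t => px (X t L 0) + -1 * px (X t 0 0)) ltac:(lra) Cg 0); try lra.
    - intros u Hu. assert (Hu1 : 0 <= u <= 1) by (rewrite Rmin_left, Rmax_right in Hu; lra).
      destruct (Hrig u Hu1) as (Hl & _ & _ & _ & Hx). pose proof (RInt_speed_pos _ _ _ _ Hf Hl).
      change (px (X u 0 0)) with (mu u). rewrite Hcrease by lra.
      destruct Hx as [Hx|Hx]; rewrite Hx by lra; lra.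
    - rewrite !HX0, !origami_param_crease, <- !crease_lm_1_0 by (apply HU; lra).
      pose proof (RInt_speed_pos _ _ _ _ Hf (slope_bound_1 _ _ _ Hf)) as K.
      change (0 < RInt (speed zeta 1) 0 L + 0 + -1 * (RInt (speed zeta 1) 0 0 + 0)).
      rewrite RInt_point. change zero with 0. lra. }
  exists lam, mu. split.
  - split; [|split; [|split; [|split; [|split; [|split]]]]].
    + apply continuous_on_mult; [|apply continuous_on_const].
      apply (continuous_on_pz _ _ (fun t => X t (L / 2) 0)), Hpath. lra.
    + apply (continuous_on_px _ _ (fun t => X t 0 0)), Hpath. lra.
    + unfold mu. rewrite HX0, origami_param_crease by (apply HU; lra).
      apply (RInt_point (V := R_CompleteNormedModule)).
    + unfold mu. rewrite HX1, developing_map_crease by (apply HU; lra).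
      apply (RInt_point (V := R_CompleteNormedModule)).
    + unfold lam. rewrite HX1, developing_map_crease by (apply HU; lra). apply Rmult_0_l.
    + unfold lam. rewrite HX0, origami_param_crease by (apply HU; lra).
      change (zeta (L / 2) * / zeta (L / 2) = 1). field. lra.
    + intros t s Ht Hs. apply (Hrig t Ht); auto.
  - intros t s v Ht Huv. pose proof Huv as [Hs Hv].
    destruct (Hrig t Ht) as (Hl & Hxi & Hy & Hz & Hx).
    assert (Hpx : forall u, 0 <= u <= L -> px (c t u) = RInt (speed zeta (lam t)) 0 u + mu t).
    (* The minus sign would make the difference of the end abscissas negative, against [Hgap]. *)
    { destruct Hx as [Hx|Hx]; [intros u Hu; rewrite Hx by auto; ring|exfalso].
      pose proof (Hgap t Ht) as K. rewrite (Hcrease t L) in K by lra.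
      change (px (X t 0 0)) with (mu t) in K. rewrite Hx in K by lra.
      pose proof (RInt_speed_pos _ _ _ _ Hf Hl). lra. }
    assert (Ec : c t s = crease_lm zeta (lam t) (mu t) s).
    { apply R3_eq; [apply Hpx|apply Hy|apply Hz]; auto. }
    destruct (H t Ht) as (Ho & _).
    assert (Hg : glued L (fun s => zeta s - b) zeta (c t) (xit t) (fun _ => xi_check) (X t))
      by (destruct Ho as [(Hg & _)|(Hg & _)]; exact Hg).
    unfold map_lm. destruct (Rle_dec 0 v).
    + rewrite (proj1 Hg s v Huv) by auto. unfold ruled. rewrite Ec, Hxi by auto. reflexivity.
    + rewrite (proj2 Hg s v Huv) by lra. unfold ruled. rewrite Ec. reflexivity.
Qed.

Theorem theorem4p5 :
  forall (b L : R) (zeta : R -> R) (M : R3 -> Prop),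
    is_pillow_box b L zeta M ->
    (forall lambda mu : R -> R,
       admissible L zeta lambda mu ->
       quarter_origami_deformation b L zeta
         (fun t s v => map_lm zeta (lambda t) (mu t) s v)) /\
    (forall X : R -> R -> R -> R3,
       quarter_origami_deformation b L zeta X ->
       exists lambda mu : R -> R,
         admissible L zeta lambda mu /\
         forall t s v, 0 <= t <= 1 -> U b L zeta s v ->
           X t s v = map_lm zeta (lambda t) (mu t) s v).
Proof.
  intros b L zeta M [Hf _]. split.
  - intros lambda mu Ha. apply map_lm_deformation; auto.
  - intros X HX. apply (deformation_is_map_lm b L zeta X Hf HX).
Qed.
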